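(* Let $(\mathcal{X},\ \rho^{B_1B_2}_x,\ \mathcal{H}^{B_1}\otimes\mathcal{H}^{B_2})$ be a classical-quantum broadcast channel, let $\mathcal{U}_1,\mathcal{U}_2$ be finite sets, $p(u_1,u_2)$ a distribution on $\mathcal{U}_1\times\mathcal{U}_2$ and $f:\mathcal{U}_1\times\mathcal{U}_2\to\mathcal{X}$ a deterministic function. Then every pair $(R_1,R_2)\in\mathbb{R}_+^2$ satisfying $$R_1\le I(U_1;B_1)_\theta,\qquad R_2\le I(U_2;B_2)_\theta,\qquad R_1+R_2\le I(U_1;B_1)_\theta+I(U_2;B_2)_\theta-I(U_1;U_2)_\theta$$ is achievable with no common message, i.e. the triple $(R_1,0,R_2)$ is achievable for the broadcast channel. Here $\theta^{U_1U_2B_1B_2}=\sum_{u_1,u_2}p(u_1,u_2)|u_1\rangle\langle u_1|^{U_1}\otimes|u_2\rangle\langle u_2|^{U_2}\otimes\rho^{B_1B_2}_{f(u_1,u_2)}$.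
   Context: A classical-quantum broadcast channel: finite $\mathcal{X}$, density operators $\rho^{B_1B_2}_x$ on finite-dimensional $\mathcal{H}^{B_1}\otimes\mathcal{H}^{B_2}$; Receiver $j$ holds $B_j$; $n$ uses give tensor products. An $(n,R_1,R,R_2,\epsilon)$ code: codebook $\{x^n(m_1,m,m_2)\}$ with $2^{nR_1},2^{nR},2^{nR_2}$ personal-1, common, personal-2 messages, POVM $\{\Lambda_{m_1,m}\}$ on $B_1^n$, POVM $\{\Gamma_{m,m_2}\}$ on $B_2^n$, with average (uniform over message triples) error $\mathrm{Tr}[(I-\Lambda_{m_1,m}\otimes\Gamma_{m,m_2})\rho^{B_1^nB_2^n}_{x^n(m_1,m,m_2)}]$ at most $\epsilon$. $(R_1,R,R_2)$ is achievable if $(n,R_1-\delta,R-\delta,R_2-\delta,\epsilon)$ codes exist for all $\epsilon,\delta>0$ and large $n$. Mutual informations are quantum (base 2); $I(U_1;U_2)$ is the classical mutual information of $p(u_1,u_2)$. *)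

(* Defs.v *)
From HB Require Import structures.
From mathcomp Require Import all_boot all_order all_algebra.
From mathcomp Require Import all_classical all_reals.
From mathcomp Require Import exp.
From mathcomp Require Import complex.
From Stdlib Require Import ClassicalEpsilon.
Set Implicit Arguments. Unset Strict Implicit. Unset Printing Implicit Defensive.
Import Order.TTheory GRing.Theory Num.Theory.
Local Open Scope ring_scope.
Local Open Scope complex_scope.

(* A finite-dimensional Hilbert space is C^I for a finite basis set I;       *)
(* an operator on it is its matrix indexed by I x I.  Tensor products of     *)
(* spaces are products of basis sets.                                        *)

Definition Op (R : realType) (I : finType) := I -> I -> R[i].

Definition opmul (R : realType) (I : finType) (A B : Op R I) : Op R I :=
  fun i j => \sum_k A i k * B k j.
Definition adj (R : realType) (I : finType) (A : Op R I) : Op R I :=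
  fun i j => (A j i)^*.
Definition opid (R : realType) (I : finType) : Op R I :=
  fun i j => (i == j)%:R.
Definition opdiag (R : realType) (I : finType) (l : I -> R) : Op R I :=
  fun i j => (i == j)%:R * (l i)%:C.
Definition optr (R : realType) (I : finType) (A : Op R I) : R[i] :=
  \sum_i A i i.
Definition optens (R : realType) (I J : finType) (A : Op R I) (B : Op R J)
  : Op R ((I * J)%type) := fun a b => A a.1 b.1 * B a.2 b.2.

(* positive semidefinite: <v, A v> >= 0 (in the order of R[i], i.e. real and
   nonnegative) for every vector v *)
Definition psd (R : realType) (I : finType) (A : Op R I) : Prop :=
  forall v : I -> R[i], 0 <= \sum_i \sum_j (v i)^* * A i j * v j.
Definition density (R : realType) (I : finType) (A : Op R I) : Prop :=
  psd A /\ optr A = 1.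
Definition unitary (R : realType) (I : finType) (U : Op R I) : Prop :=
  opmul U (adj U) = @opid R I /\ opmul (adj U) U = @opid R I.
Definition povm (R : realType) (I M : finType) (L : M -> Op R I) : Prop :=
  (forall m, psd (L m)) /\ (forall i j, \sum_m L m i j = @opid R I i j).

Definition spectrum (R : realType) (I : finType) (A : Op R I) (l : I -> R)
  : Prop := exists U : Op R I, unitary U /\ A = opmul (opmul U (opdiag l)) (adj U).
Definition eigvals (R : realType) (I : finType) (A : Op R I) : I -> R :=
  epsilon (inhabits (fun _ => 0)) (spectrum A).
Definition log2 (R : realType) (x : R) : R := ln x / ln 2.
(* S(A) = - Tr A log2 A = - sum_i l_i log2 l_i  (0 log 0 = 0) *)
Definition vN_entropy (R : realType) (I : finType) (A : Op R I) : R :=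
  \sum_i - (eigvals A i * log2 (eigvals A i)).

Definition ptr2 (R : realType) (I J : finType) (A : Op R ((I * J)%type)) : Op R I :=
  fun i i' => \sum_j A (i, j) (i', j).
Definition ptr1 (R : realType) (I J : finType) (A : Op R ((I * J)%type)) : Op R J :=
  fun j j' => \sum_i A (i, j) (i, j').
Definition qmi (R : realType) (I J : finType) (A : Op R ((I * J)%type)) : R :=
  vN_entropy (ptr2 A) + vN_entropy (ptr1 A) - vN_entropy A.
Definition relabel (R : realType) (I J : finType) (e : J -> I) (A : Op R I)
  : Op R J := fun j j' => A (e j) (e j').

Definition theta (R : realType) (X U1 U2 I1 I2 : finType)
  (rho : X -> Op R ((I1 * I2)%type)) (p : U1 -> U2 -> R) (f : U1 -> U2 -> X)
  : Op R ((((U1 * U2)%type) * ((I1 * I2)%type))%type) :=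
  fun a b => (a.1 == b.1)%:R * (p a.1.1 a.1.2)%:C * rho (f a.1.1 a.1.2) a.2 b.2.

Definition reorder1 (U1 U2 I1 I2 : finType) (a : ((U1 * I1)%type) * ((U2 * I2)%type))
  : ((U1 * U2)%type) * ((I1 * I2)%type) := ((a.1.1, a.2.1), (a.1.2, a.2.2)).
Definition reorder2 (U1 U2 I1 I2 : finType) (a : ((U2 * I2)%type) * ((U1 * I1)%type))
  : ((U1 * U2)%type) * ((I1 * I2)%type) := ((a.2.1, a.1.1), (a.2.2, a.1.2)).

Definition theta_U1B1 (R : realType) (X U1 U2 I1 I2 : finType) (rho : X -> Op R ((I1 * I2)%type))
  (p : U1 -> U2 -> R) (f : U1 -> U2 -> X) : Op R ((U1 * I1)%type) :=
  ptr2 (relabel (@reorder1 U1 U2 I1 I2) (theta rho p f)).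
Definition theta_U2B2 (R : realType) (X U1 U2 I1 I2 : finType) (rho : X -> Op R ((I1 * I2)%type))
  (p : U1 -> U2 -> R) (f : U1 -> U2 -> X) : Op R ((U2 * I2)%type) :=
  ptr2 (relabel (@reorder2 U1 U2 I1 I2) (theta rho p f)).
Definition theta_U1U2 (R : realType) (X U1 U2 I1 I2 : finType) (rho : X -> Op R ((I1 * I2)%type))
  (p : U1 -> U2 -> R) (f : U1 -> U2 -> X) : Op R ((U1 * U2)%type) :=
  ptr2 (theta rho p f).

(* Basis of B_j^n : functions 'I_n -> I_j.  The output state of codeword x^n
   on B1^n B2^n is  (x)_k rho_{x_k},  rearranged as B1^n (x) B2^n. *)
Definition nstate (R : realType) (X I1 I2 : finType) (rho : X -> Op R ((I1 * I2)%type))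
  (n : nat) (x : 'I_n -> X) : Op R (({ffun 'I_n -> I1} * {ffun 'I_n -> I2})%type) :=
  fun a b => \prod_(k < n) rho (x k) (a.1 k, a.2 k) (b.1 k, b.2 k).

Record bc_code (R : realType) (X I1 I2 : finType) (rho : X -> Op R ((I1 * I2)%type))
  (n M1 M M2 : nat) := BCCode {
  enc : 'I_M1 -> 'I_M -> 'I_M2 -> 'I_n -> X;
  dec1 : ('I_M1 * 'I_M)%type -> Op R {ffun 'I_n -> I1};
  dec2 : ('I_M * 'I_M2)%type -> Op R {ffun 'I_n -> I2};
  dec1_povm : povm dec1;
  dec2_povm : povm dec2 }.

Definition avg_err (R : realType) (X I1 I2 : finType) (rho : X -> Op R ((I1 * I2)%type))
  (n M1 M M2 : nat)
  (c : @bc_code R X I1 I2 rho n M1 M M2) : R[i] :=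
  (M1 * M * M2)%:R^-1 *
  \sum_(m1 < M1) \sum_(m < M) \sum_(m2 < M2)
     optr (opmul (fun a b => @opid R _ a b - optens (dec1 c (m1, m)) (dec2 c (m, m2)) a b)
                 (nstate rho (enc c m1 m m2))).

(* M is the number of messages 2^{n r}, i.e. M = ceil(2^{n r}) *)
Definition msg_count (R : realType) (n : nat) (r : R) (M : nat) : Prop :=
  ((M.-1)%:R < 2 `^ (n%:R * r)) /\ (2 `^ (n%:R * r) <= M%:R).

Definition code_exists (R : realType) (X I1 I2 : finType) (rho : X -> Op R ((I1 * I2)%type))
  (n : nat) (r1 r r2 eps : R) : Prop :=
  exists M1 M M2, msg_count n r1 M1 /\ msg_count n r M /\ msg_count n r2 M2 /\
    exists c : @bc_code R X I1 I2 rho n M1 M M2, avg_err c <= eps%:C.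

Definition achievable (R : realType) (X I1 I2 : finType) (rho : X -> Op R ((I1 * I2)%type)) (r1 r r2 : R) : Prop :=
  forall eps delta : R, 0 < eps -> 0 < delta ->
    exists N : nat, forall n : nat, (N <= n)%N ->
      code_exists rho n (r1 - delta) (r - delta) (r2 - delta) eps.

(* Main.v *)
(* Random coding.  Each message m_j owns K_j codewords, drawn from the j-th
   marginal p_j^n of p^n.  For a message pair the encoder may use any pair of
   codewords from the two lists, and takes the one with the smallest error.
   That error is at most the average of the errors weighted by the truncated
   likelihood ratio w = p^n / (p_1^n p_2^n), up to the deviation of the total
   weight from 1, which a second moment computation shows to be small as soon
   as K_1 and K_2 are large and K_1 K_2 exceeds 2^(n I(U1;U2)).  Weighting by w
   replaces the independent pair by one drawn from p^n, so the weighted average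
   decouples into the error probabilities of two point-to-point
   classical-quantum channels, because
   I - A (x) B <= (I - A) (x) I + I (x) (I - B) for 0 <= A, B <= I.

   For a point-to-point channel the receiver first projects onto the subspace
   where the average state has small eigenvalues, and then measures, one
   codeword after the other, the projections onto the large eigenvalues of
   their output states.  Gao's noncommutative union bound gives an expected
   error of order M K 2^(-n I(U;B)).  Both thresholds are on products of
   eigenvalues, so that typicality is the weak law of large numbers for the
   logarithms of eigenvalues, whose means are the von Neumann entropies. *)
Require Import Defs.
From HB Require Import structures.
From mathcomp Require Import all_boot all_order all_algebra.
From mathcomp Require Import all_classical all_reals.
From mathcomp Require Import exp.
From mathcomp Require Import complex spectral sesquilinear.
From mathcomp Require Import ring lra.
From Stdlib Require Import ClassicalEpsilon.
Import Order.TTheory GRing.Theory Num.Theory.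
Local Open Scope ring_scope.

Section Marton.
Set Implicit Arguments. Unset Strict Implicit. Unset Printing Implicit Defensive.
Local Open Scope complex_scope.
Local Open Scope sesquilinear_scope.
Local Open Scope ring_scope.

(** * Product distributions on finite sequences *)

Section FiniteProducts.

Lemma sum_pair (V : nmodType) (I J : finType) (F : I * J -> V) :
  \sum_p F p = \sum_i \sum_j F (i, j).
Proof. by rewrite pair_bigA; apply: eq_bigr; case. Qed.

Lemma sum_ffun_prod (R : comNzRingType) (I J : finType) (F : I -> J -> R) :
  \sum_(c : {ffun I -> J}) \prod_i F i (c i) = \prod_i \sum_j F i j.
Proof. by rewrite bigA_distr_bigA. Qed.

Lemma sum_ffun_prodD1 (R : comNzRingType) (I J : finType) (P : I -> J -> R)
    (i0 : I) (g : J -> R) :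
  \sum_(c : {ffun I -> J}) (\prod_(i | i != i0) P i (c i)) * g (c i0) =
  (\prod_(i | i != i0) \sum_j P i j) * \sum_j g j.
Proof.
transitivity (\sum_(c : {ffun I -> J})
    \prod_i (if i == i0 then g (c i) else P i (c i))).
  apply: eq_bigr => c _; rewrite [RHS](bigD1 i0) //= eqxx mulrC; congr (_ * _).
  by apply: eq_bigr => i /negbTE ->.
rewrite (@sum_ffun_prod _ _ _ (fun i j => if i == i0 then g j else P i j)).
rewrite (bigD1 i0) //= eqxx mulrC; congr (_ * _).
by apply: eq_bigr => i /negbTE ->.
Qed.

(** The factor at [i0] is left out because [g] is meant to carry its own weight there, such as an
    unnormalised state whose trace is the missing probability. *)
Lemma marginal1 (R : comNzRingType) (I J : finType) (p : J -> R) (i0 : I)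
    (g : J -> R) : \sum_j p j = 1 ->
  \sum_(c : {ffun I -> J}) (\prod_(i | i != i0) p (c i)) * g (c i0) =
  \sum_j g j.
Proof.
move=> p1; rewrite (@sum_ffun_prodD1 _ _ _ (fun=> p)).
by rewrite big1 ?mul1r.
Qed.

Lemma marginal2 (R : comNzRingType) (I J : finType) (p : J -> R) (i0 i1 : I)
    (g : J -> J -> R) : \sum_j p j = 1 -> i1 != i0 ->
  \sum_(c : {ffun I -> J}) (\prod_(i | i != i0) p (c i)) * g (c i0) (c i1) =
  \sum_j' p j' * \sum_j g j j'.
Proof.
move=> p1 i10.
(* Fixing the value [j'] of [c i1] by an indicator, absorbed into the factor at [i1], gives a
   summand of product form. *)
transitivity (\sum_j' \sum_(c : {ffun I -> J})
   (\prod_(i | i != i0) (p (c i) * (if i == i1 then (c i == j')%:R else 1)))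
   * g (c i0) j').
  rewrite exchange_big /=; apply: eq_bigr => c _.
  rewrite (bigD1 (c i1)) //= big_split /= [X in _ * X * _]big1 ?mulr1; last first.
    by move=> i _; case: eqP => // ->; rewrite eqxx.
  rewrite [X in _ + X]big1 ?addr0 // => j /negbTE nj.
  rewrite [X in X * _](bigD1 i1) //= eqxx eq_sym nj.
  by rewrite mulr0 !mul0r.
apply: eq_bigr => j _.
rewrite (@sum_ffun_prodD1 _ _ _
  (fun i v => p v * (if i == i1 then (v == j)%:R else 1)) i0 (fun v => g v j)).
congr (_ * _).
rewrite (bigD1 i1) //= eqxx [X in _ * X]big1 ?mulr1; last first.
  move=> i /andP[_ /negbTE ->]; rewrite -[RHS]p1.
  by apply: eq_bigr => v _; rewrite mulr1.
rewrite (bigD1 j) //= eqxx mulr1 big1 ?addr0 // => v /negbTE ->.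
by rewrite mulr0.
Qed.

Definition prodw (R : comNzRingType) (I J : finType) (p : J -> R)
  (c : {ffun I -> J}) : R := \prod_i p (c i).

Lemma prodw_ge0 (R : numDomainType) (I J : finType) (p : J -> R)
  (c : {ffun I -> J}) : (forall j, 0 <= p j) -> 0 <= prodw p c.
Proof. by move=> p0; apply: prodr_ge0. Qed.

Lemma prodw_sum (R : comNzRingType) (I J : finType) (p : J -> R) :
  \sum_j p j = 1 -> \sum_(c : {ffun I -> J}) prodw p c = 1.
Proof.
by move=> p1; rewrite (@sum_ffun_prod _ _ _ (fun=> p)) big1.
Qed.

Lemma prodwD1 (R : comNzRingType) (I J : finType) (p : J -> R) (i0 : I)
    (c : {ffun I -> J}) :
  prodw p c = (\prod_(i | i != i0) p (c i)) * p (c i0).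
Proof. by rewrite /prodw (bigD1 i0) //= mulrC. Qed.

Lemma expect_one (R : comNzRingType) (I J : finType) (p : J -> R) (i0 : I)
    (g : J -> R) : \sum_j p j = 1 ->
  \sum_(c : {ffun I -> J}) prodw p c * g (c i0) = \sum_j p j * g j.
Proof.
move=> p1; rewrite -(marginal1 i0 (fun j => p j * g j) p1).
by apply: eq_bigr => c _; rewrite (prodwD1 p i0) mulrA.
Qed.

Lemma expect_pair (R : comNzRingType) (I J : finType) (p : J -> R) (i0 i1 : I)
    (g : J -> J -> R) : \sum_j p j = 1 ->
  \sum_(c : {ffun I -> J}) prodw p c * g (c i0) (c i1) =
  if i0 == i1 then \sum_j p j * g j j
  else \sum_j p j * \sum_j' p j' * g j j'.
Proof.
move=> p1; case: eqP => [->|/eqP n01].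
  exact: (expect_one i1 (fun j => g j j)).
transitivity (\sum_j' p j' * \sum_j p j * g j j').
  rewrite -(marginal2 (fun j j' => p j * g j j') p1 (i0 := i0) (i1 := i1)).
    by apply: eq_bigr => c _; rewrite (prodwD1 p i0) mulrA.
  by rewrite eq_sym.
under eq_bigr do rewrite mulr_sumr; rewrite exchange_big /=.
apply: eq_bigr => j _; rewrite mulr_sumr; apply: eq_bigr => j' _.
by rewrite mulrCA.
Qed.

(** * Powers of two and the weak law of large numbers *)

Lemma log2K (R : realType) (x : R) : 0 < x -> 2 `^ (log2 x) = x.
Proof.
move=> x0; rewrite /powR pnatr_eq0 /= /log2 divfK ?lnK //.
by rewrite gt_eqF // ln_gt0 // ltr1n.
Qed.

Lemma pow2_gt0 (R : realType) (x : R) : 0 < (2 : R) `^ x.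
Proof. by rewrite powR_gt0. Qed.

Lemma pow2D (R : realType) (x y : R) : (2 : R) `^ (x + y) = 2 `^ x * 2 `^ y.
Proof. by rewrite powRD // pnatr_eq0 implybT. Qed.

Lemma pow2N (R : realType) (x : R) : (2 : R) `^ (- x) = (2 `^ x)^-1.
Proof. by rewrite powRN. Qed.

Lemma prod_log2 (R : realType) (I : finType) (r : I -> R) :
  (forall i, 0 < r i) -> \prod_i r i = 2 `^ (\sum_i log2 (r i)).
Proof.
move=> r0; elim/big_rec2 : _ => [|i x y _ ->]; first by rewrite powRr0.
by rewrite pow2D log2K.
Qed.

(** The cross terms vanish because [Y] has mean zero, which leaves the [n] diagonal ones. *)
Lemma iid_variance (R : realType) (O : finType) (q Y : O -> R) (n : nat) :
  \sum_o q o = 1 -> \sum_o q o * Y o = 0 ->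
  \sum_(w : {ffun 'I_n -> O}) prodw q w * (\sum_k Y (w k)) ^+ 2 =
  n%:R * \sum_o q o * Y o ^+ 2.
Proof.
move=> q1 Y0.
transitivity (\sum_(k < n) \sum_(l < n) \sum_(w : {ffun 'I_n -> O})
   prodw q w * (Y (w k) * Y (w l))).
  rewrite [RHS](eq_bigr (fun k : 'I_n => \sum_(w : {ffun 'I_n -> O})
     prodw q w * (Y (w k) * \sum_l Y (w l)))); last first.
    move=> k _; rewrite exchange_big /=; apply: eq_bigr => w _.
    by rewrite !mulr_sumr.
  rewrite exchange_big /=; apply: eq_bigr => w _.
  by rewrite -mulr_sumr -mulr_suml expr2.
rewrite (eq_bigr (fun=> \sum_o q o * Y o ^+ 2)); last first.
  move=> k _; rewrite (bigD1 k) //= (@expect_pair _ _ _ q k k (fun x y => Y x * Y y)) //.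
  rewrite eqxx [X in _ + X]big1 ?addr0 //= => l kl.
  rewrite (@expect_pair _ _ _ q k l (fun x y => Y x * Y y)) // eq_sym (negbTE kl).
  apply: big1 => o _; rewrite (eq_bigr (fun o' => Y o * (q o' * Y o'))); last first.
    by move=> o' _; rewrite mulrCA.
  by rewrite -mulr_sumr Y0 !mulr0.
by rewrite sumr_const card_ord mulr_natl.
Qed.

(** Chebyshev's inequality for the logarithm of the product: [Y] is the centred [log2 (r o)], and
    exceeding the threshold forces its sum along the sequence above [n d]. *)
Lemma iid_product_large (R : realType) (O : finType) (q r : O -> R) (d e : R) :
  (forall o, 0 <= q o) -> \sum_o q o = 1 -> (forall o, 0 < q o -> 0 < r o) ->
  0 < d -> 0 < e ->
  exists N : nat, forall n : nat, (N <= n)%N ->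
   \sum_(w : {ffun 'I_n -> O} |
      2 `^ (n%:R * ((\sum_o q o * log2 (r o)) + d)) < \prod_k r (w k))
    prodw q w <= e.
Proof.
move=> q0 q1 qr d0 e0; set m := \sum_o _.
pose Y o := log2 (r o) - m; pose V := \sum_o q o * Y o ^+ 2.
have V0 : 0 <= V by apply: sumr_ge0 => o _; rewrite mulr_ge0 ?sqr_ge0.
have Y0 : \sum_o q o * Y o = 0.
  rewrite /Y; under eq_bigr do rewrite mulrBr.
  by rewrite big_split /= sumrN -mulr_suml q1 mul1r subrr.
have [N HN] : exists N : nat, V / (d ^+ 2 * e) < N%:R.
  exists (Num.bound (V / (d ^+ 2 * e))).
  by apply: archi_boundP; rewrite divr_ge0 // mulr_ge0 ?sqr_ge0 ?ltW.
exists N.+1 => n Nn.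
have n0 : 0 < n%:R :> R by rewrite ltr0n (leq_trans _ Nn).
apply: (@le_trans _ _ (\sum_(w : {ffun 'I_n -> O})
    prodw q w * ((\sum_k Y (w k)) ^+ 2 / (n%:R * d) ^+ 2))).
  rewrite big_mkcond /=; apply: ler_sum => w _.
  have W0 : 0 <= prodw q w by apply: prodw_ge0.
  have B0 : 0 <= (\sum_k Y (w k)) ^+ 2 / (n%:R * d) ^+ 2.
    by rewrite divr_ge0 ?sqr_ge0.
  case: ifP => [big|_]; last exact: mulr_ge0.
  (* Sequences of weight zero are set aside: [r] is known to be positive only where [q] is, and the
     logarithm needs positive factors. *)
  have [->|Wn0] := eqVneq (prodw q w) 0; first by rewrite mul0r.
  have qw k : 0 < q (w k).
    rewrite lt_neqAle q0 andbT eq_sym; apply: contraNneq Wn0 => qk.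
    by rewrite (prodwD1 q k) qk mulr0.
  rewrite ler_peMr // ler_pdivlMr ?exprn_gt0 ?mulr_gt0 // mul1r.
  suff S0 : n%:R * d <= \sum_k Y (w k).
    have nd0 : 0 <= n%:R * d by rewrite mulr_ge0 ?ltW.
    by rewrite ler_sqr ?nnegrE // (le_trans nd0).
  move: big; rewrite prod_log2; last by move=> k; apply: qr.
  rewrite (_ : \sum_k log2 _ = n%:R * m + \sum_k Y (w k)); last first.
    rewrite /Y big_split /= sumrN sumr_const card_ord mulr_natl; ring.
  rewrite ltNge => /negP big; rewrite leNgt; apply/negP => S0; apply: big.
  by rewrite ler_powR ?ler1n // mulrDr lerD2l; apply: ltW.
under eq_bigr do rewrite mulrA.
rewrite -mulr_suml iid_variance // -/V.
rewrite (_ : _ / _ = V / d ^+ 2 / n%:R); last by field; rewrite !gt_eqF.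
rewrite ler_pdivrMr // [leRHS]mulrC -ler_pdivrMr // -mulrA -invfM.
apply: (le_trans (ltW HN)); rewrite ler_nat; exact: ltnW.
Qed.

End FiniteProducts.

(** * Operators on finite-dimensional spaces *)

Section Operators.
Variable R : realType.
Implicit Types (I J K : finType).

(* Every conjugate is forced to live in [R[i]] with the ring structure found by
   type inference there: [Num.conj] would bring in the (convertible, but
   syntactically different) structure of [R[i]] as a closed field. *)
Definition cconj (z : R[i]) : R[i] := conjc z.
Local Notation "z ^*" := (cconj z) : ring_scope.

Lemma cconjD x y : (x + y)^* = x^* + y^*.
Proof. by case: x => a b; case: y => c d; rewrite /cconj /= opprD. Qed.

Lemma cconjM x y : (x * y)^* = x^* * y^*.
Proof. exact: (rmorphM (@conjc R)). Qed.

Lemma cconjK x : x^* ^* = x.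
Proof. exact: conjcK. Qed.

Lemma cconj_real (a : R) : (a%:C)^* = a%:C.
Proof. exact: conjc_real. Qed.

Lemma cconj_nat n : (n%:R)^* = n%:R.
Proof. exact: conjc_nat. Qed.

Lemma cconj_sum (T : Type) (s : seq T) (P : pred T) (F : T -> R[i]) :
  (\sum_(i <- s | P i) F i)^* = \sum_(i <- s | P i) (F i)^*.
Proof. exact: (big_morph _ cconjD (cconj_nat 0)). Qed.

Lemma cconj_prod (T : Type) (s : seq T) (P : pred T) (F : T -> R[i]) :
  (\prod_(i <- s | P i) F i)^* = \prod_(i <- s | P i) (F i)^*.
Proof. exact: (big_morph _ cconjM (cconj_nat 1)). Qed.

Definition normsq (z : R[i]) : R := complex.Re z ^+ 2 + complex.Im z ^+ 2.

Lemma normsq_ge0 z : 0 <= normsq z.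
Proof. by rewrite addr_ge0 ?sqr_ge0. Qed.

Lemma mulJc (z : R[i]) : z^* * z = (normsq z)%:C.
Proof.
case: z => a b; rewrite /normsq /=.
by congr Complex; rewrite ?mulNr ?opprK -?expr2 // [b * a]mulrC subrr.
Qed.

Lemma mulcJ (z : R[i]) : z * z^* = (normsq z)%:C.
Proof. by rewrite mulrC mulJc. Qed.

Lemma ReD (x y : R[i]) : complex.Re (x + y) = complex.Re x + complex.Re y.
Proof. by case: x; case: y. Qed.

Lemma Re_sum (T : Type) (s : seq T) (P : pred T) (F : T -> R[i]) :
  complex.Re (\sum_(i <- s | P i) F i) = \sum_(i <- s | P i) complex.Re (F i).
Proof. by apply: (big_morph _ ReD). Qed.

Lemma ReZ (a : R) (x : R[i]) : complex.Re (a%:C * x) = a * complex.Re x.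
Proof. by case: x => b c /=; rewrite mul0r subr0. Qed.

Lemma realc_sum (T : Type) (s : seq T) (P : pred T) (F : T -> R) :
  (\sum_(i <- s | P i) F i)%:C = \sum_(i <- s | P i) (F i)%:C :> R[i].
Proof. exact: (rmorph_sum (real_complex R)). Qed.

Lemma realc_prod (T : Type) (s : seq T) (P : pred T) (F : T -> R) :
  (\prod_(i <- s | P i) F i)%:C = \prod_(i <- s | P i) (F i)%:C :> R[i].
Proof. exact: (rmorph_prod (real_complex R)). Qed.

Lemma sum_delta (T : finType) (i : T) (F : T -> R[i]) :
  \sum_k (k == i)%:R * F k = F i.
Proof.
rewrite (bigD1 i) //= eqxx mul1r big1 ?addr0 // => k /negbTE ->.
by rewrite mul0r.
Qed.

(** * Quadratic forms, Gram operators and positivity *)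

Definition app I K (A : K -> I -> R[i]) (v : I -> R[i]) : K -> R[i] :=
  fun k => \sum_i A k i * v i.
Definition nsq I (v : I -> R[i]) : R := \sum_i normsq (v i).
Definition qf I (A : Op R I) (v : I -> R[i]) : R[i] :=
  \sum_i \sum_j (v i)^* * A i j * v j.
(** The operator $B^*B$, where [B] may be rectangular. Every positive semidefinite operator has this
    form, by [psd_factor], so that positivity becomes a sum of squared moduli. *)
Definition gram K I (B : K -> I -> R[i]) : Op R I :=
  fun i j => \sum_k (B k i)^* * B k j.

Lemma nsq_ge0 I (v : I -> R[i]) : 0 <= nsq v.
Proof. by apply: sumr_ge0 => i _; apply: normsq_ge0. Qed.

Lemma qf_gram K I (B : K -> I -> R[i]) v : qf (gram B) v = (nsq (app B v))%:C.
Proof.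
rewrite /nsq realc_sum.
under [RHS]eq_bigr do rewrite -mulJc /app cconj_sum mulr_suml.
rewrite [RHS]exchange_big /=; apply: eq_bigr => i _.
under [RHS]eq_bigr do rewrite mulr_sumr.
rewrite [RHS]exchange_big /=; apply: eq_bigr => j _.
rewrite mulr_sumr mulr_suml; apply: eq_bigr => k _.
by rewrite cconjM; ring.
Qed.

Lemma psdE I (A : Op R I) : psd A <-> forall v, 0 <= qf A v.
Proof. by []. Qed.

Lemma psd_gram K I (B : K -> I -> R[i]) : psd (gram B).
Proof. by apply/psdE => v; rewrite qf_gram ler0c nsq_ge0. Qed.

Lemma qf_two I (A : Op R I) (i j : I) (x y : R[i]) :
  qf A (fun k => (k == i)%:R * x + (k == j)%:R * y) =
  x^* * (A i i * x + A i j * y) + y^* * (A j i * x + A j j * y).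
Proof.
have row k : \sum_l A k l * ((l == i)%:R * x + (l == j)%:R * y) =
    A k i * x + A k j * y.
  rewrite -(sum_delta i (fun l => A k l * x)) -(sum_delta j (fun l => A k l * y)).
  by rewrite -big_split /=; apply: eq_bigr => l _; ring.
rewrite /qf -(sum_delta i (fun k => x^* * (A k i * x + A k j * y))).
rewrite -(sum_delta j (fun k => y^* * (A k i * x + A k j * y))).
rewrite -big_split /=; apply: eq_bigr => k _.
under eq_bigr do rewrite -mulrA.
by rewrite -mulr_sumr row cconjD !cconjM !cconj_nat; ring.
Qed.

(** Being nonnegative, the quadratic form is real at every vector. Basis vectors give real diagonal
    entries; then $e_i+e_j$ makes the imaginary parts of [A i j] and [A j i] opposite, and
    $e_i+\mathrm{i}e_j$ makes their real parts equal. *)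
Lemma psd_hermitian I (A : Op R I) i j : psd A -> A i j = (A j i)^*.
Proof.
move=> pA.
have im v : complex.Im (qf A v) = 0 by apply: ger0_Im; apply: (psdE A).1.
have d k : complex.Im (A k k) = 0.
  have := im (fun l => (l == k)%:R * 1 + (l == k)%:R * 0); rewrite qf_two.
  by rewrite !mulr0 !addr0 (cconj_nat 0) mul0r addr0 (cconj_nat 1) mul1r mulr1.
have h1 := im (fun l => (l == i)%:R * 1 + (l == j)%:R * 1).
have h2 := im (fun l => (l == i)%:R * 1 + (l == j)%:R * 'i%C).
move: h1 h2 (d i) (d j); rewrite !qf_two.
case: (A i j) => a b; case: (A j i) => a' b'.
case: (A i i) => c c'; case: (A j j) => e e' /= h1 h2 h3 h4.
by congr Complex; move: h1 h2; rewrite h3 h4; lra.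
Qed.

(** * Diagonalisation and entropy *)

Lemma unitary_colE I (U : Op R I) : unitary U ->
  forall i j, \sum_k (U k i)^* * U k j = (i == j)%:R.
Proof. by case=> _ /(congr1 (fun f : Op R I => f)) h i j; rewrite -[RHS]/(opid R i j) -h. Qed.

Lemma unitary_rowE I (U : Op R I) : unitary U ->
  forall i j, \sum_k U i k * (U j k)^* = (i == j)%:R.
Proof. by case=> h _ i j; rewrite -[RHS]/(opid R i j) -h. Qed.

Lemma diagonalE I (U : Op R I) (l : I -> R) :
  opmul (opmul U (opdiag l)) (adj U) =
  fun i j => \sum_k (l k)%:C * (U i k * (U j k)^*).
Proof.
apply/funext => i; apply/funext => j; apply: eq_bigr => k _.
rewrite /opmul /opdiag (eq_bigr (fun m => (m == k)%:R * (U i m * (l m)%:C))); last first.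
  by move=> m _; rewrite mulrCA.
by rewrite sum_delta /adj; ring.
Qed.

(** The spectral theorem for Hermitian matrices is transported along the enumeration of [I]; an
    eigenvalue is the quadratic form at its eigenvector, hence nonnegative. *)
Lemma spectral_psd I (A : Op R I) : psd A ->
  exists U : Op R I, exists2 l : I -> R,
    unitary U /\ A = opmul (opmul U (opdiag l)) (adj U) & forall i, 0 <= l i.
Proof.
move=> pA.
pose M : 'M[R[i]]_#|I| := \matrix_(i, j) A (enum_val i) (enum_val j).
have hM : M \is hermsymmx.
  apply/is_hermitianmxP/matrixP => i j; rewrite expr0 scale1r !mxE.
  exact: psd_hermitian.
pose P := spectralmx M; pose D := spectral_diag M.
have uP : P \is unitarymx := spectral_unitarymx M.
have eM : M = P^t* *m diag_mx D *m P.
  by rewrite -invmx_unitary //; apply/orthomx_spectralP/hermitian_normalmx.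
pose l i : R := complex.Re (D 0 (enum_rank i)).
have lE i : D 0 (enum_rank i) = (l i)%:C.
  rewrite /l RRe_real //.
  by have /mxOverP := hermitian_spectral_diag_real hM; apply.
(* The rows of [P] are the conjugated eigenvectors, whereas [U] has the eigenvectors as its
   columns. *)
pose U : Op R I := fun i k => (P (enum_rank k) (enum_rank i))^*.
have reidx (F : 'I_#|I| -> R[i]) : \sum_k F k = \sum_(i : I) F (enum_rank i).
  by rewrite (reindex (@enum_rank I)) //; apply: onW_bij; apply: enum_rank_bij.
have uU : unitary U.
  split; apply/funext => i; apply/funext => j.
    have /matrixP/(_ (enum_rank i) (enum_rank j)) : P^t* *m P = 1%:M.
      by rewrite -invmx_unitary // mulVmx // unitarymx_unit.
    rewrite !mxE reidx (inj_eq enum_rank_inj) /opid => <-.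
    by apply: eq_bigr => k _; rewrite !mxE /adj /U -!/(cconj _) ?cconjK.
  have /matrixP/(_ (enum_rank i) (enum_rank j)) := unitarymxP uP.
  rewrite !mxE reidx (inj_eq enum_rank_inj) /opid => <-.
  by apply: eq_bigr => k _; rewrite !mxE /adj /U -!/(cconj _) ?cconjK.
have eA : A = opmul (opmul U (opdiag l)) (adj U).
  rewrite diagonalE; apply/funext => i; apply/funext => j.
  have /matrixP/(_ (enum_rank i) (enum_rank j)) := eM.
  rewrite !mxE !enum_rankK reidx => ->; apply: eq_bigr => k _.
  rewrite mul_mx_diag !mxE lE /U cconjK; ring.
exists U, l; first by split.
move=> k; rewrite -ler0c.
have := (psdE A).1 pA (U^~ k).
suff -> : qf A (U^~ k) = (l k)%:C by [].
rewrite -(sum_delta k (fun m => (l m)%:C)) eA diagonalE /qf.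
transitivity (\sum_m (l m)%:C * ((\sum_i (U i k)^* * U i m) * (\sum_j (U j m)^* * U j k))).
  under [RHS]eq_bigr do rewrite mulr_suml mulr_sumr.
  rewrite [RHS]exchange_big; apply: eq_bigr => i _.
  under [RHS]eq_bigr do rewrite mulr_sumr mulr_sumr.
  rewrite [RHS]exchange_big; apply: eq_bigr => j _.
  rewrite mulr_sumr mulr_suml; apply: eq_bigr => m _; ring.
apply: eq_bigr => m _; rewrite !unitary_colE // eq_sym; case: eqP => _ /=.
  by rewrite mul1r mulrC.
by rewrite !mul0r mulr0.
Qed.

(** The matrix [W] is $V^*U$. It intertwines the two diagonals, so [W i j] vanishes unless
    [l j = l' i], and its squared moduli are doubly stochastic. Hence the entropy, defined through a
    chosen spectrum, can be computed from any diagonalisation. *)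
Lemma spectrum_sum_uniq I (A : Op R I) (l l' : I -> R) (g : R -> R) :
  spectrum A l -> spectrum A l' -> \sum_i g (l i) = \sum_i g (l' i).
Proof.
case=> U [uU ->] [V [uV e]].
pose W i j : R[i] := \sum_k (V k i)^* * U k j.
have wl i j : W i j * (l j)%:C = (l' i)%:C * W i j.
  transitivity (\sum_k \sum_m (V k i)^* *
      (opmul (opmul U (opdiag l)) (adj U) k m) * U m j).
    rewrite diagonalE (eq_bigr (fun k => (V k i)^* * U k j * (l j)%:C)).
      by rewrite -mulr_suml.
    move=> k _; rewrite -(sum_delta j (fun n => (V k i)^* * U k n * (l n)%:C)).
    under eq_bigr do rewrite mulr_sumr mulr_suml.
    rewrite exchange_big; apply: eq_bigr => n _ /=.
    rewrite -(unitary_colE uU) mulr_suml; apply: eq_bigr => m _; ring.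
  rewrite e diagonalE exchange_big /=.
  rewrite (eq_bigr (fun m => (l' i)%:C * ((V m i)^* * U m j))).
    by rewrite -mulr_sumr.
  move=> m _; rewrite -(sum_delta i (fun n => (l' n)%:C * ((V m n)^* * U m j))).
  under eq_bigr do rewrite mulr_sumr mulr_suml.
  rewrite exchange_big; apply: eq_bigr => n _ /=.
  rewrite eq_sym -(unitary_colE uV) mulr_suml; apply: eq_bigr => k _; ring.
have W1 j : \sum_i normsq (W i j) = 1.
  apply: complexI; rewrite realc_sum.
  transitivity (\sum_i \sum_k \sum_m (U k j)^* * U m j * (V k i * (V m i)^*)).
    apply: eq_bigr => i _; rewrite -mulJc cconj_sum mulr_suml; apply: eq_bigr => k _.
    rewrite mulr_sumr; apply: eq_bigr => m _.
    by rewrite cconjM cconjK; ring.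
  rewrite exchange_big /= [RHS](_ : _ = \sum_k (U k j)^* * U k j); last first.
    by rewrite unitary_colE // eqxx.
  apply: eq_bigr => k _; rewrite exchange_big /=.
  rewrite -(sum_delta k (fun m => (U k j)^* * U m j)); apply: eq_bigr => m _.
  by rewrite -mulr_sumr unitary_rowE // eq_sym mulrC.
have W2 i : \sum_j normsq (W i j) = 1.
  apply: complexI; rewrite realc_sum.
  transitivity (\sum_j \sum_k \sum_m (V k i)^* * V m i * (U k j * (U m j)^*)).
    apply: eq_bigr => j _; rewrite -mulcJ cconj_sum mulr_suml; apply: eq_bigr => k _.
    rewrite mulr_sumr; apply: eq_bigr => m _.
    by rewrite cconjM cconjK; ring.
  rewrite exchange_big /= [RHS](_ : _ = \sum_k (V k i)^* * V k i); last first.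
    by rewrite unitary_colE // eqxx.
  apply: eq_bigr => k _; rewrite exchange_big /=.
  rewrite -(sum_delta k (fun m => (V k i)^* * V m i)); apply: eq_bigr => m _.
  by rewrite -mulr_sumr unitary_rowE // eq_sym mulrC.
transitivity (\sum_j \sum_i normsq (W i j) * g (l j)).
  by apply: eq_bigr => j _; rewrite -mulr_suml W1 mul1r.
rewrite exchange_big /=; apply: eq_bigr => i _.
rewrite -[RHS]mul1r -(W2 i) mulr_suml; apply: eq_bigr => j _.
have [->|Wn] := eqVneq (W i j) 0; first by rewrite /normsq /= expr0n /= addr0 !mul0r.
congr (_ * g _); apply: complexI; apply: (mulfI Wn).
by rewrite wl mulrC.
Qed.

Lemma vN_entropyE I (A : Op R I) (l : I -> R) : spectrum A l ->
  vN_entropy A = - \sum_i l i * log2 (l i).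
Proof.
move=> sl; rewrite /vN_entropy sumrN; congr (- _).
apply: (@spectrum_sum_uniq _ A _ _ (fun x => x * log2 x)) => //.
by apply: epsilon_spec; exists l.
Qed.

Lemma psd_factor I (A : Op R I) : psd A -> exists B : Op R I, A = gram B.
Proof.
case/spectral_psd => U [l [uU ->] l0].
exists (fun k i => (Num.sqrt (l k))%:C * (U i k)^*).
rewrite diagonalE; apply/funext => i; apply/funext => j; apply: eq_bigr => k _.
rewrite cconjM cconjK cconj_real -{1}(sqr_sqrtr (l0 k)) rmorphXn /= expr2; ring.
Qed.

(** By cyclicity of the trace this is the squared Hilbert-Schmidt norm of $BD^*$; it makes the trace
    of a product of two positive operators nonnegative. *)
Lemma optr_gram_gram (K L I : finType) (B : K -> I -> R[i]) (D : L -> I -> R[i]) :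
  optr (opmul (gram B) (gram D)) =
  (\sum_k \sum_l normsq (\sum_i B k i * (D l i)^*))%:C.
Proof.
rewrite realc_sum.
transitivity (\sum_k \sum_l \sum_i \sum_j ((B k i)^* * B k j * ((D l j)^* * D l i))).
  rewrite /optr /opmul /gram.
  under eq_bigr => i _ do under eq_bigr => j _ do rewrite mulr_suml.
  under eq_bigr => i _ do rewrite exchange_big.
  rewrite exchange_big; apply: eq_bigr => k _ /=.
  under eq_bigr => i _ do under eq_bigr => j _ do rewrite mulr_sumr.
  under eq_bigr => i _ do rewrite exchange_big.
  by rewrite exchange_big.
apply: eq_bigr => k _; rewrite realc_sum; apply: eq_bigr => l _.
rewrite -mulJc cconj_sum mulr_suml; apply: eq_bigr => i _.
rewrite mulr_sumr; apply: eq_bigr => j _.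
by rewrite cconjM cconjK; ring.
Qed.

Lemma optr_psd_ge0 I (A B : Op R I) : psd A -> psd B -> 0 <= optr (opmul A B).
Proof.
move=> /psd_factor[C ->] /psd_factor[D ->].
rewrite optr_gram_gram ler0c; apply: sumr_ge0 => k _; apply: sumr_ge0 => l _.
exact: normsq_ge0.
Qed.

Lemma psd_optens I J (A : Op R I) (B : Op R J) : psd A -> psd B -> psd (optens A B).
Proof.
move=> /psd_factor[C ->] /psd_factor[D ->].
suff -> : optens (gram C) (gram D) =
   gram (fun (k : I * J) (a : I * J) => C k.1 a.1 * D k.2 a.2) by apply: psd_gram.
apply/funext => a; apply/funext => b; rewrite /optens /gram.
rewrite -(pair_bigA _ (fun k l => (C k a.1 * D l a.2)^* * (C k b.1 * D l b.2))) /=.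
rewrite mulr_suml; apply: eq_bigr => k _; rewrite mulr_sumr; apply: eq_bigr => l _.
by rewrite cconjM; ring.
Qed.

Lemma psd_sum I (T : Type) (s : seq T) (P : pred T) (A : T -> Op R I) :
  (forall t, P t -> psd (A t)) -> psd (fun i j => \sum_(t <- s | P t) A t i j).
Proof.
move=> pA; apply/psdE => v.
rewrite (_ : qf _ v = \sum_(t <- s | P t) qf (A t) v).
  by apply: sumr_ge0 => t /pA/(psdE (A t)).1.
rewrite [RHS]exchange_big /=; apply: eq_bigr => i _.
rewrite exchange_big /=; apply: eq_bigr => j _.
by rewrite mulr_sumr mulr_suml.
Qed.

Lemma psd_opid I : psd (@opid R I).
Proof.
suff -> : @opid R I = gram (@opid R I) by apply: psd_gram.
apply/funext => i; apply/funext => j; rewrite /gram /opid -(sum_delta i (fun k => (k == j)%:R)).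
by apply: eq_bigr => k _; rewrite cconj_nat.
Qed.

End Operators.

(** * Sequences of orthogonal projections *)

Section SequentialProjections.
Variables (R : realFieldType) (V : zmodType) (ip : V -> V -> R).
Hypothesis ipC : forall x y, ip x y = ip y x.
Hypothesis ipB : forall x y z, ip (x - y) z = ip x z - ip y z.
Hypothesis ip_ge0 : forall x, 0 <= ip x x.

(* The second identity is self-adjointness and idempotence in one equation. *)
Definition orthoproj (P : V -> V) :=
  (forall x y, P (x - y) = P x - P y) /\
  (forall x y, ip x (P y) = ip (P x) (P y)).

Lemma ipBr x y z : ip z (x - y) = ip z x - ip z y.
Proof. by rewrite ipC ipB !(ipC _ z). Qed.

Lemma ip_amgm x y : ip x y <= ip x x + ip y y / 4.
Proof.
(* The vector [x - (y - x)] is $2x-y$, written with subtraction because that is the operation [ip]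
   is assumed to respect. *)
have := ip_ge0 (x - (y - x)).
rewrite !(ipB, ipBr) [ip y x]ipC; lra.
Qed.

Lemma ip_parallelogram x y : ip (x - y) (x - y) <= 2 * ip x x + 2 * ip y y.
Proof.
have := ip_ge0 (x - (0 - y)).
have ip0 z : ip 0 z = 0 by rewrite -(subrr 0) ipB subrr.
rewrite !(ipB, ipBr) !ip0 ![ip _ 0]ipC !ip0 [ip y x]ipC; lra.
Qed.

Lemma orthoproj_pythagoras P x : orthoproj P ->
  ip x x = ip (P x) (P x) + ip (x - P x) (x - P x).
Proof. by case=> _ h; rewrite !(ipB, ipBr) [ip (P x) x]ipC !(h x x); ring. Qed.

Lemma orthoproj_compl P : orthoproj P -> orthoproj (fun x => x - P x).
Proof.
case=> hB h; split=> x y.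
  by rewrite hB !opprB [P y - P x]addrC addrACA [- y + _]addrC.
rewrite !(ipB, ipBr) [ip (P x) y]ipC (h x y) (h y x) [ip (P y) _]ipC; ring.
Qed.

Variables (T : eqType) (P : T -> V -> V).
Hypothesis Pproj : forall t, orthoproj (P t).

(* The unnormalised state after the outcomes of the yes/no measurements
   [P j], [j] in [s], are no up to [t] and yes at [t]. *)
Fixpoint seqproj (s : seq T) (x : V) (t : T) : V :=
  if s is j :: s' then
    if j == t then P j x else seqproj s' (x - P j x) t
  else 0.

(** Each measurement splits the squared norm orthogonally into a yes part, which is recorded, and a
    no part, which is measured further. This makes the operators of the decoder sum to at most the
    identity. *)
Lemma seqproj_sum s x : uniq s ->
  \sum_(t <- s) ip (seqproj s x t) (seqproj s x t) <= ip x x.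
Proof.
elim: s x => [|j s IH] x /= => [_|/andP[js us]]; first by rewrite big_nil.
rewrite big_cons eqxx (orthoproj_pythagoras x (Pproj j)) lerD2l.
rewrite (eq_big_seq (fun t =>
  ip (seqproj s (x - P j x) t) (seqproj s (x - P j x) t))) ?IH // => t ts.
by case: eqP => // jt; rewrite jt ts in js.
Qed.

(** The loss [x - seqproj s x t] telescopes into the components removed by the no outcomes before
    [t] and the one that [P t] rejects. Each is paired with [v], its projection is moved onto [v],
    and [ip_amgm] applies; by Pythagoras the quarters of squared norms telescope to the last term.
    Keeping [v] apart from [x] lets the induction change [x] alone. *)
Lemma seqproj_deviation s v x t : t \in s -> uniq s ->
  ip v (x - seqproj s x t) <=
    ip (v - P t v) (v - P t v) + \sum_(j <- s | j != t) ip (P j v) (P j v)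
    + (ip x x - ip (seqproj s x t) (seqproj s x t)) / 4.
Proof.
elim: s x => [//|j s IH] x /=; rewrite inE => ts /andP[js us].
rewrite big_cons eq_sym; have [->|jt] /= := eqVneq t j.
  have : 0 <= \sum_(i <- s | i != j) ip (P i v) (P i v) by apply: sumr_ge0.
  have [_ /(_ v x) ->] := orthoproj_compl (Pproj j).
  rewrite (orthoproj_pythagoras x (Pproj j)).
  have := ip_amgm (v - P j v) (x - P j x).
  lra.
have {}ts : t \in s by move: ts; rewrite (negbTE jt).
have := IH (x - P j x) ts us.
set b := seqproj _ _ _.
have -> : ip v (x - b) = ip v (P j x) + ip v (x - P j x - b).
  by rewrite !ipBr; ring.
have [_ /(_ v x) ->] := Pproj j.
rewrite (orthoproj_pythagoras x (Pproj j)).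
have := ip_amgm (P j v) (P j x); lra.
Qed.

(* Gao's noncommutative union bound: [|x - b|^2 >= 0] turns the bound on
   [<x, x - b>] into one on [|x|^2 - |b|^2]. *)
Lemma seqproj_union_bound s x t : t \in s -> uniq s ->
  ip x x - ip (seqproj s x t) (seqproj s x t) <=
  4 * (ip (x - P t x) (x - P t x) + \sum_(j <- s | j != t) ip (P j x) (P j x)).
Proof.
move=> ts us; have := seqproj_deviation x x ts us.
have := ip_ge0 (x - seqproj s x t).
rewrite !(ipB, ipBr) [ip (seqproj _ _ _) x]ipC; lra.
Qed.

(** The union bound is applied at [Q v], and the failure of [P t] there is charged to [v] at the
    cost of a factor 2. Together with the loss of [Q] itself this gives the constants 1 + 4 * 2 = 9
    and 4 * 2 = 8. *)
Lemma seqproj_sandwiched_bound Q s v t : orthoproj Q -> t \in s -> uniq s ->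
  ip v v - ip (seqproj s (Q v) t) (seqproj s (Q v) t) <=
  9 * ip (v - Q v) (v - Q v) + 8 * ip (v - P t v) (v - P t v) +
  4 * \sum_(j <- s | j != t) ip (P j (Q v)) (P j (Q v)).
Proof.
move=> Qp ts us; have := seqproj_union_bound (Q v) ts us.
rewrite (orthoproj_pythagoras v Qp).
suff : ip (Q v - P t (Q v)) (Q v - P t (Q v)) <=
    2 * ip (v - P t v) (v - P t v) + 2 * ip (v - Q v) (v - Q v) by lra.
have -> : Q v - P t (Q v) = (v - P t v) - ((v - Q v) - P t (v - Q v)).
  by have [/(_ v (v - Q v)) <- _] := orthoproj_compl (Pproj t); rewrite subKr.
apply: (le_trans (ip_parallelogram _ _)); rewrite lerD2l ler_pM2l //.
by rewrite [leRHS](orthoproj_pythagoras _ (Pproj t)) lerDr.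
Qed.

End SequentialProjections.

(** * Packing: sequential decoding of a random codebook *)

Section PackingDecoder.
Variable R : realType.
Implicit Types (I J K : finType).
Local Notation "z ^*" := (cconj z) : ring_scope.

Definition cip I (v w : I -> R[i]) : R[i] := \sum_i (v i)^* * w i.
(** The real part turns the complex space into a real inner product space with the same norm, to
    which the bounds on sequences of projections apply. *)
Definition rip I (v w : I -> R[i]) : R := complex.Re (cip v w).

Lemma ReN (z : R[i]) : complex.Re (- z) = - complex.Re z.
Proof. by case: z. Qed.

Lemma normsqE (z : R[i]) : normsq z = complex.Re (z^* * z).
Proof. by rewrite mulJc. Qed.

Lemma rip_nsq I (v : I -> R[i]) : rip v v = nsq v.
Proof. by rewrite /rip Re_sum; apply: eq_bigr => i _; rewrite normsqE. Qed.

Lemma ripC I (v w : I -> R[i]) : rip v w = rip w v.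
Proof.
rewrite /rip !Re_sum; apply: eq_bigr => i _.
by case: (v i) => a b; case: (w i) => c d /=; ring.
Qed.

Lemma ripBl I (v v' w : I -> R[i]) : rip (v - v') w = rip v w - rip v' w.
Proof.
rewrite /rip -ReN -ReD /cip -sumrN -big_split; congr complex.Re.
apply: eq_bigr => i _ /=.
rewrite (_ : (v - v') i = v i - v' i) // cconjD.
by rewrite (_ : (- v' i)^* = - (v' i)^*) ?mulrDl ?mulNr // /cconj rmorphN.
Qed.

Lemma rip_ge0 I (v : I -> R[i]) : 0 <= rip v v.
Proof. by rewrite rip_nsq nsq_ge0. Qed.

Lemma app_opmul I (A B : Op R I) v : app (opmul A B) v = app A (app B v).
Proof.
apply/funext => i; rewrite /app /opmul.
under eq_bigr do rewrite mulr_suml; rewrite exchange_big /=.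
apply: eq_bigr => k _; rewrite mulr_sumr; apply: eq_bigr => j _; ring.
Qed.

Lemma app_opid I (v : I -> R[i]) : app (@opid R I) v = v.
Proof.
apply/funext => i; rewrite /app /opid -[RHS](sum_delta i v).
by apply: eq_bigr => k _; rewrite eq_sym.
Qed.

Lemma app_subr I (A : Op R I) v w : app A (v - w) = app A v - app A w.
Proof.
apply/funext => i; rewrite (_ : (app A v - app A w) i = app A v i - app A w i) //.
rewrite /app -sumrN -big_split; apply: eq_bigr => j _ /=.
by rewrite (_ : (v - w) j = v j - w j) // mulrBr.
Qed.

Definition opsub I (A B : Op R I) : Op R I := fun i j => A i j - B i j.

Lemma app_opsub I (A B : Op R I) v : app (opsub A B) v = app A v - app B v.
Proof.
apply/funext => i; rewrite (_ : (app A v - app B v) i = app A v i - app B v i) //.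
by rewrite /app -sumrN -big_split; apply: eq_bigr => j _ /=; rewrite mulrBl.
Qed.

Lemma qf_opsub I (A B : Op R I) v : qf (opsub A B) v = qf A v - qf B v.
Proof.
rewrite /qf -sumrN -big_split; apply: eq_bigr => i _ /=.
by rewrite -sumrN -big_split; apply: eq_bigr => j _ /=; rewrite mulrBr mulrBl.
Qed.

Lemma qf_sum I (T : Type) (s : seq T) (P : pred T) (A : T -> Op R I) v :
  qf (fun i j => \sum_(t <- s | P t) A t i j) v = \sum_(t <- s | P t) qf (A t) v.
Proof.
rewrite [RHS]exchange_big /=; apply: eq_bigr => i _.
by rewrite exchange_big /=; apply: eq_bigr => j _; rewrite mulr_sumr mulr_suml.
Qed.

Lemma qf_opid I (v : I -> R[i]) : qf (@opid R I) v = (nsq v)%:C.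
Proof.
rewrite /nsq realc_sum; apply: eq_bigr => i _.
rewrite -mulJc -(sum_delta i (fun j => (v i)^* * v j)).
by apply: eq_bigr => j _; rewrite /opid eq_sym; ring.
Qed.

(** * Spectral projections and sequential measurements *)

Definition projop I (U : Op R I) (S : pred I) : Op R I :=
  fun i j => \sum_(k | S k) U i k * (U j k)^*.

Lemma app_projop I (U : Op R I) S v i :
  app (projop U S) v i = \sum_(k | S k) U i k * cip (U^~ k) v.
Proof.
rewrite /app /projop; under eq_bigr do rewrite mulr_suml.
rewrite exchange_big /=; apply: eq_bigr => k _.
by rewrite mulr_sumr; apply: eq_bigr => j _; rewrite mulrA.
Qed.

Lemma cip_projop I (U : Op R I) S v k : unitary U ->
  cip (U^~ k) (app (projop U S) v) = if S k then cip (U^~ k) v else 0.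
Proof.
move=> uU; rewrite /cip.
transitivity (\sum_(l | S l) (k == l)%:R * cip (U^~ l) v).
  under eq_bigr do rewrite app_projop mulr_sumr.
  rewrite exchange_big /=; apply: eq_bigr => l _.
  rewrite -(unitary_colE uU) mulr_suml; apply: eq_bigr => i _; ring.
rewrite big_mkcond (bigD1 k) //= eqxx big1 ?addr0.
  by case: ifP => //; rewrite mul1r.
by move=> l lk; rewrite eq_sym (negbTE lk) mul0r if_same.
Qed.

Lemma cip_projr I (U : Op R I) S v w :
  cip v (app (projop U S) w) = \sum_(k | S k) (cip (U^~ k) v)^* * cip (U^~ k) w.
Proof.
rewrite {1}/cip; under eq_bigr do rewrite app_projop mulr_sumr.
rewrite exchange_big /=; apply: eq_bigr => k _.
rewrite [cip _ v]/cip cconj_sum mulr_suml; apply: eq_bigr => i _.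
by rewrite cconjM cconjK; ring.
Qed.

Lemma projop_ortho I (U : Op R I) S : unitary U ->
  orthoproj (@rip I) (app (projop U S)).
Proof.
move=> uU; split=> v w; first exact: app_subr.
congr complex.Re; rewrite !cip_projr; apply: eq_bigr => k Sk.
by rewrite cip_projop // Sk.
Qed.

Lemma nsq_projop I (U : Op R I) S v : unitary U ->
  nsq (app (projop U S) v) = \sum_(k | S k) normsq (cip (U^~ k) v).
Proof.
move=> uU; have [_ h] := projop_ortho S uU.
by rewrite -rip_nsq -h /rip cip_projr Re_sum; apply: eq_bigr => k _; rewrite normsqE.
Qed.

Lemma app_projop_col I (U : Op R I) (S : pred I) k : unitary U ->
  app (projop U S) (U^~ k) = if S k then U^~ k else 0.
Proof.
move=> uU; apply/funext => i; rewrite app_projop.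
rewrite (eq_bigr (fun l => (l == k)%:R * U i l)); last first.
  by move=> l _; rewrite /cip unitary_colE // mulrC.
rewrite big_mkcond (bigD1 k) //= eqxx big1 ?addr0.
  by case: ifP => //; rewrite mul1r.
by move=> l /negbTE ->; rewrite mul0r if_same.
Qed.

Lemma nsq_col I (U : Op R I) k : unitary U -> nsq (U^~ k) = 1.
Proof. by move=> uU; rewrite -rip_nsq /rip /cip unitary_colE // eqxx. Qed.

Lemma parseval I (W : Op R I) (v : I -> R[i]) : unitary W ->
  \sum_k normsq (cip v (W^~ k)) = nsq v.
Proof.
move=> uW; apply: complexI; rewrite !realc_sum.
transitivity (\sum_k \sum_i \sum_j ((v i)^* * v j) * (W i k * (W j k)^*)).
  apply: eq_bigr => k _; rewrite -mulcJ /cip cconj_sum mulr_suml.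
  apply: eq_bigr => i _; rewrite mulr_sumr; apply: eq_bigr => j _.
  by rewrite cconjM cconjK; ring.
rewrite exchange_big; apply: eq_bigr => i _ /=.
rewrite exchange_big -mulJc -(sum_delta i (fun j => (v i)^* * v j)) /=.
apply: eq_bigr => j _; rewrite -mulr_sumr unitary_rowE // eq_sym; ring.
Qed.

(** The operator behind [seqproj], with what has been applied so far accumulated in [A]; [opsub A A]
    is the zero operator, for an outcome absent from [s]. *)
Fixpoint seqop I (T : eqType) (P : T -> Op R I) (s : seq T) (A : Op R I) (t : T)
  : Op R I :=
  if s is j :: s' then
    if j == t then opmul (P j) A else seqop P s' (opsub A (opmul (P j) A)) t
  else opsub A A.

Lemma app_seqop I (T : eqType) (P : T -> Op R I) s A t v :
  app (seqop P s A t) v = seqproj (fun j => app (P j)) s (app A v) t.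
Proof.
elim: s A => [|j s IH] A /=; first by rewrite app_opsub subrr.
case: ifP => _; first by rewrite app_opmul.
by rewrite IH app_opsub app_opmul.
Qed.

(** [L t] is $B^*B$ for [B] the product of [Q], the no outcomes before [t] and the yes outcome at
    [t]; its quadratic form is the squared norm of what [seqproj] leaves. *)
Lemma sequential_decoder I (T : finType) (Q : Op R I) (P : T -> Op R I) :
  orthoproj (@rip I) (app Q) -> (forall t, orthoproj (@rip I) (app (P t))) ->
  exists L : T -> Op R I,
   [/\ forall t, psd (L t),
       psd (opsub (@opid R I) (fun i j => \sum_t L t i j)) &
       forall t v, nsq v - complex.Re (qf (L t) v) <=
         9 * nsq (v - app Q v) + 8 * nsq (v - app (P t) v) +
         4 * \sum_(j | j != t) nsq (app (P j) (app Q v))].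
Proof.
move=> Qp Pp; exists (fun t => gram (seqop P (index_enum T) Q t)).
have enumT : uniq (index_enum T) by exact: index_enum_uniq.
split=> [t||t v]; first exact: psd_gram.
  apply/(psdE _) => v; rewrite qf_opsub qf_opid qf_sum.
  under eq_bigr do rewrite qf_gram app_seqop -rip_nsq.
  rewrite -realc_sum subr_ge0 lecR.
  apply: (le_trans (seqproj_sum (@ripC I) (@ripBl I) (@rip_ge0 I) Pp _ enumT)).
  rewrite -(rip_nsq v) [leRHS](orthoproj_pythagoras (@ripC I) (@ripBl I) v Qp).
  by rewrite lerDl rip_ge0.
rewrite qf_gram /= app_seqop -!rip_nsq.
under [X in _ + 4 * X]eq_bigr do rewrite -rip_nsq.
by apply: (seqproj_sandwiched_bound (@ripC I) (@ripBl I) (@rip_ge0 I)) => //;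
  exact: mem_index_enum.
Qed.

(** * Packing with eigenvalue thresholds *)

Definition diagform I (U : Op R I) (l : I -> R) (A : Op R I) :=
  [/\ unitary U, forall i j, A i j = \sum_k (l k)%:C * (U i k * (U j k)^*)
    & forall k, 0 <= l k].

Lemma psd_diagform I (A : Op R I) : psd A -> exists U, exists l, diagform U l A.
Proof.
move=> /spectral_psd[U [l [uU eA] l0]]; exists U, l; split => // i j.
by rewrite {1}eA diagonalE.
Qed.

Lemma diagform_spectrum I U l (A : Op R I) : diagform U l A -> spectrum A l.
Proof.
case=> uU eA _; exists U; split=> //.
by rewrite diagonalE; apply/funext => i; apply/funext => j; rewrite eA.
Qed.

Lemma optr_diagform I U l (A B : Op R I) : diagform U l B ->
  optr (opmul A B) = \sum_k (l k)%:C * qf A (U^~ k).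
Proof.
case=> _ eB _; rewrite /optr /opmul /qf.
under [RHS]eq_bigr do rewrite mulr_sumr.
rewrite [RHS]exchange_big; apply: eq_bigr => i _ /=.
under [RHS]eq_bigr do rewrite mulr_sumr.
rewrite [RHS]exchange_big; apply: eq_bigr => j _ /=.
rewrite eB mulr_sumr; apply: eq_bigr => k _; rewrite -/(cconj _); ring.
Qed.

Definition rtr I (A B : Op R I) : R := complex.Re (optr (opmul A B)).

Lemma rtr_diagform I U l (A B : Op R I) : diagform U l B ->
  rtr A B = \sum_k l k * complex.Re (qf A (U^~ k)).
Proof.
move=> dB; rewrite /rtr (optr_diagform _ dB) Re_sum.
by apply: eq_bigr => k _; rewrite ReZ.
Qed.

(** Both sides are the trace of $B^*B$ against $\sum_v s_v$. Averages over codewords can thereby be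
    computed in the eigenbasis of the average state. *)
Lemma diagform_sum_eq I (V : finType) (s : V -> Op R I) U mu W lam (B : Op R I) :
  (forall v, diagform (U v) (mu v) (s v)) ->
  diagform W lam (fun i j => \sum_v s v i j) ->
  \sum_v \sum_k mu v k * nsq (app B ((U v)^~ k)) =
  \sum_k lam k * nsq (app B (W^~ k)).
Proof.
move=> ds dW.
have h U' l A : diagform U' l A ->
    \sum_k l k * nsq (app B (U'^~ k)) = rtr (gram B) A.
  by move=> /rtr_diagform ->; apply: eq_bigr => k _; rewrite qf_gram.
under eq_bigr do rewrite (h _ _ _ (ds _)).
rewrite (h _ _ _ dW) /rtr -Re_sum /optr exchange_big; congr complex.Re.
apply: eq_bigr => i _; rewrite /opmul exchange_big /=.
by apply: eq_bigr => j _; rewrite mulr_sumr.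
Qed.

Lemma optr_diag I U l (A : Op R I) : diagform U l A -> optr A = (\sum_k l k)%:C.
Proof.
case=> uU eA _; rewrite /optr realc_sum.
under eq_bigr do rewrite eA; rewrite exchange_big; apply: eq_bigr => k _ /=.
rewrite -mulr_sumr (eq_bigr (fun i => (U i k)^* * U i k)).
  by rewrite unitary_colE // eqxx mulr1.
by move=> i _; rewrite mulrC.
Qed.

(* The operators [s v] are unnormalised, with trace the probability [q v] of
   the codeword [v], which is why the weight of the codeword [c (m, k)] is left
   out of the product: the sum is the expected error of message [m] when [v] is
   transmitted at position [(m, k)] and the other codewords are drawn from [q]. *)
Definition good_decoder (V J : finType) (q : V -> R) (s : V -> Op R J)
    (M K : nat) (e : R) := exists D : {ffun 'I_M * 'I_K -> V} -> 'I_M -> Op R J,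
  (forall c, povm (D c)) /\
  forall m k, \sum_(c : {ffun 'I_M * 'I_K -> V}) (\prod_(j | j != (m, k)) q (c j)) *
     rtr (opsub (@opid R J) (D c m)) (s (c (m, k))) <= e.

(** The receiver always announces the only message, so [K] is unconstrained. This serves the rates
    that become nonpositive once the slack is subtracted. *)
Lemma good_decoder_single (V J : finType) (q : V -> R) (s : V -> Op R J) (K : nat) :
  good_decoder q s 1 K 0.
Proof.
exists (fun _ _ => @opid R J); split.
  by move=> c; split => [_|i j]; [exact: psd_opid | rewrite big_ord1].
move=> m k; rewrite big1 // => c _; rewrite /rtr /optr /opmul /opsub [X in complex.Re X]big1 ?mulr0 //.
by move=> i _; rewrite big1 // => j _; rewrite subrr mul0r.
Qed.

(** The three terms are the mass that [Q] cuts off the average state, the mass that the projections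
    [P v] cut off their own states, and the interference of the other codewords. One interfering
    codeword contributes at most [a / b] on average: [Q] caps the average state at [a], and for
    positive [q v] the rank of [P v] is at most [1 / b], since eigenvalues of size at least
    [q v * b] add up to at most [q v]. *)
Lemma good_decoder_packing (V J : finType) (q : V -> R) (s : V -> Op R J)
    U mu W lam (a b : R) (M K : nat) :
  (forall v, 0 <= q v) -> \sum_v q v = 1 -> (forall v, optr (s v) = (q v)%:C) ->
  (forall v, diagform (U v) (mu v) (s v)) ->
  diagform W lam (fun i j => \sum_v s v i j) ->
  0 <= a -> 0 < b -> (0 < M)%N ->
  good_decoder q s M K
    (9 * \sum_(k | a < lam k) lam k
     + 8 * (\sum_v \sum_(k | mu v k < q v * b) mu v k)
     + 4 * ((M * K)%:R * (a / b))).
Proof.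
move=> q0 q1 trs ds dW a0 b0 M0.
have uU v : unitary (U v) by case: (ds v).
have mu0 v k : 0 <= mu v k by case: (ds v).
have [uW _ lam0] := dW.
pose Q := projop W (fun k => lam k <= a).
pose P v := projop (U v) (fun k => q v * b <= mu v k).
have Qp : orthoproj (@rip J) (app Q) by apply: projop_ortho.
have Pp v : orthoproj (@rip J) (app (P v)) by apply: projop_ortho.
have /choice[L HL] (c : {ffun 'I_M * 'I_K -> V}) :=
  sequential_decoder (P := fun j => P (c j)) Qp (fun j => Pp (c j)).
have [m0 _] : exists m0 : 'I_M, true by exists (Ordinal M0).
pose rest c : Op R J := opsub (@opid R J) (fun i j => \sum_t L c t i j).
(* The outcomes are summed over the list of [m], and what is missing from the identity is assigned
   to [m0]; being positive, these additions can only lower the error. *)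
exists (fun c m => fun i j => \sum_k L c (m, k) i j + (m == m0)%:R * rest c i j).
split=> [c|m k].
  have [Lp Rp _] := HL c; split.
    move=> m; apply/(psdE _) => v.
    rewrite (_ : qf _ v = \sum_k qf (L c (m, k)) v + (m == m0)%:R * qf (rest c) v).
      apply: addr_ge0; first by apply: sumr_ge0 => k _; apply: (psdE _).1.
      by rewrite mulr_ge0 ?ler0n //; apply: (psdE _).1.
    rewrite -qf_sum /qf mulr_sumr -big_split; apply: eq_bigr => i _ /=.
    rewrite mulr_sumr -big_split; apply: eq_bigr => j _ /=; ring.
  move=> i j; rewrite big_split /= -mulr_suml [X in X * rest c i j](bigD1 m0) //= eqxx.
  rewrite [X in (1 + X)]big1 ?addr0 ?mul1r; last by move=> m /negbTE ->.
  rewrite (pair_bigA _ (fun m k => L c (m, k) i j)) /= /rest /opsub.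
  rewrite (eq_bigr (fun t => L c t i j)); first by rewrite addrC subrK.
  by case.
pose f1 v := \sum_k mu v k * nsq ((U v)^~ k - app Q ((U v)^~ k)).
pose f2 v := \sum_k mu v k * nsq ((U v)^~ k - app (P v) ((U v)^~ k)).
pose f3 v v' := \sum_k mu v k * nsq (app (P v') (app Q ((U v)^~ k))).
apply: (@le_trans _ _ (\sum_(c : {ffun 'I_M * 'I_K -> V})
  (\prod_(j | j != (m, k)) q (c j)) * (9 * f1 (c (m, k)) + 8 * f2 (c (m, k))
  + 4 * \sum_(j | j != (m, k)) f3 (c (m, k)) (c j)))).
  apply: ler_sum => c _; apply: ler_wpM2l; first by apply: prodr_ge0.
  rewrite (rtr_diagform _ (ds _)) /f1 /f2 /f3 exchange_big /= !mulr_sumr.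
  rewrite -!big_split; apply: ler_sum => l _ /=.
  rewrite -mulr_sumr !(mulrCA _ (mu _ _)) -!mulrDr; apply: ler_wpM2l => //.
  have [Lp Rp Lb] := HL c.
  apply: le_trans (Lb (m, k) ((U (c (m, k)))^~ l)).
  rewrite qf_opsub qf_opid ReD ReN /= lerD2l lerN2.
  set v := (U _)^~ l.
  have -> : qf (fun i j => \sum_k L c (m, k) i j + (m == m0)%:R * rest c i j) v =
      qf (L c (m, k)) v + (\sum_(k' | k' != k) qf (L c (m, k')) v
        + (m == m0)%:R * qf (rest c) v).
    rewrite addrA -(bigD1 k (P := predT) (F := fun k' => qf (L c (m, k')) v)) //=.
    rewrite -qf_sum /qf mulr_sumr -big_split; apply: eq_bigr => i _ /=.
    rewrite mulr_sumr -big_split; apply: eq_bigr => j _ /=; ring.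
  rewrite [leRHS]ReD lerDl.
  suff : 0 <= \sum_(k' | k' != k) qf (L c (m, k')) v + (m == m0)%:R * qf (rest c) v.
      by rewrite lecE => /andP[_].
  apply: addr_ge0; first by apply: sumr_ge0 => k' _; apply: (psdE _).1.
  by rewrite mulr_ge0 ?ler0n //; apply: (psdE _).1.
under eq_bigr do rewrite mulrDr (mulrCA _ 4).
have /= E1 := marginal1 (m, k) (fun v => 9 * f1 v + 8 * f2 v) q1.
rewrite big_split /= E1 big_split /= -!mulr_sumr.
under [X in _ + 4 * X <= _]eq_bigr do rewrite mulr_sumr.
have h1 : \sum_v f1 v = \sum_(k | a < lam k) lam k.
  rewrite /f1; under eq_bigr do under eq_bigr do
    rewrite -[X in X - _]app_opid -app_opsub.
  rewrite (diagform_sum_eq _ ds dW) [RHS]big_mkcond; apply: eq_bigr => l _.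
  rewrite app_opsub app_opid app_projop_col // ltNge.
  case: ifP => _ /=; last by rewrite subr0 nsq_col // mulr1.
  by rewrite subrr /nsq big1 ?mulr0 // => i _; rewrite /normsq /= expr0n /= addr0.
have h2 : \sum_v f2 v = \sum_v \sum_(l | mu v l < q v * b) mu v l.
  apply: eq_bigr => v _; rewrite /f2 [RHS]big_mkcond; apply: eq_bigr => l _.
  rewrite app_projop_col // ltNge.
  case: ifP => _ /=; last by rewrite subr0 nsq_col // mulr1.
  by rewrite subrr /nsq big1 ?mulr0 // => i _; rewrite /normsq /= expr0n /= addr0.
(* In the eigenbasis of the average state [Q] keeps only eigenvalues at most [a], and what remains
   is at most [a] times the rank of [P v']. *)
have h3 v' : \sum_v f3 v v' <= a * (\sum_(l | q v' * b <= mu v' l) 1).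
  rewrite /f3; under eq_bigr do under eq_bigr do rewrite -app_opmul.
  rewrite (diagform_sum_eq _ ds dW).
  apply: (@le_trans _ _ (a * \sum_l nsq (app (P v') (W^~ l)))).
    rewrite mulr_sumr; apply: ler_sum => l _.
    rewrite app_opmul app_projop_col //; case: ifP => la.
      by rewrite ler_wpM2r ?nsq_ge0.
    rewrite -[0](subrr 0) app_subr subrr.
    rewrite (_ : nsq 0 = 0) ?mulr0 ?mulr_ge0 ?nsq_ge0 //.
    by rewrite /nsq big1 // => i _; rewrite /normsq /= expr0n /= addr0.
  rewrite ler_wpM2l //; under eq_bigr do rewrite nsq_projop //.
  rewrite exchange_big /=; apply: ler_sum => l _.
  by rewrite parseval // nsq_col.
rewrite h1 h2 lerD2l ler_wpM2l // exchange_big /=.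
apply: (@le_trans _ _ (\sum_(j | j != (m, k)) a / b)); last first.
  rewrite sumr_const -[_ *+ _]mulr_natl; apply: ler_wpM2r.
    by rewrite divr_ge0 // ltW.
  by rewrite ler_nat (leq_trans (max_card _)) // card_prod !card_ord.
apply: ler_sum => j jmk; rewrite (marginal2 f3 q1 jmk).
apply: (@le_trans _ _ (\sum_v' a / b * \sum_l mu v' l)).
  apply: ler_sum => v _; apply: (le_trans (ler_wpM2l (q0 v) (h3 v))).
  rewrite mulrCA -mulrA; apply: ler_wpM2l => //.
  rewrite mulr_sumr mulr_sumr big_mkcond /=; apply: ler_sum => l _.
  case: ifP => [h|_]; last by rewrite mulr_ge0 ?invr_ge0 // ltW.
  by rewrite mulr1 mulrC ler_pdivlMr.
rewrite -mulr_sumr (_ : \sum_v _ = 1) ?mulr1 // -q1; apply: eq_bigr => v _.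
by apply: complexI; rewrite -(optr_diag (ds v)).
Qed.

End PackingDecoder.

(** * Covering: likelihood-ratio selection of a codeword pair *)

Section OneShotMarton.

Section Covering.
Variables (R : realType) (V1 V2 : finType) (P : V1 -> V2 -> R) (t : R).
Hypothesis P0 : forall v1 v2, 0 <= P v1 v2.
Hypothesis P1 : \sum_v1 \sum_v2 P v1 v2 = 1.
Hypothesis t0 : 0 <= t.

Definition marg_l v1 := \sum_v2 P v1 v2.
Definition marg_r v2 := \sum_v1 P v1 v2.
Definition atypical v1 v2 := t * (marg_l v1 * marg_r v2) < P v1 v2.

(* Where a marginal vanishes so does [P], and the value [0 / 0 = 0] keeps
   [marg_l v1 * marg_r v2 * lr_weight v1 v2 = P v1 v2] for typical pairs. *)
Definition lr_weight v1 v2 : R :=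
  if atypical v1 v2 then 0 else P v1 v2 / (marg_l v1 * marg_r v2).

Lemma marg_l_ge0 v1 : 0 <= marg_l v1.
Proof. exact: sumr_ge0. Qed.

Lemma marg_r_ge0 v2 : 0 <= marg_r v2.
Proof. exact: sumr_ge0. Qed.

Lemma marg_l_sum : \sum_v1 marg_l v1 = 1.
Proof. exact: P1. Qed.

Lemma marg_r_sum : \sum_v2 marg_r v2 = 1.
Proof. by rewrite exchange_big; exact: P1. Qed.

Lemma le_marg_l v1 v2 : P v1 v2 <= marg_l v1.
Proof. by rewrite /marg_l (bigD1 v2) //= lerDl sumr_ge0. Qed.

Lemma le_marg_r v1 v2 : P v1 v2 <= marg_r v2.
Proof. by rewrite /marg_r (bigD1 v1) //= lerDl sumr_ge0. Qed.

Lemma marg_mul_eq0 v1 v2 : marg_l v1 * marg_r v2 = 0 -> P v1 v2 = 0.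
Proof.
move=> /eqP; rewrite mulf_eq0 => h; apply/eqP; rewrite eq_le P0 andbT.
by case/orP: h => /eqP <-; [exact: le_marg_l|exact: le_marg_r].
Qed.

Lemma lr_weight_ge0 v1 v2 : 0 <= lr_weight v1 v2.
Proof.
by rewrite /lr_weight; case: ifP => // _; rewrite divr_ge0 ?mulr_ge0 ?marg_l_ge0 ?marg_r_ge0.
Qed.

Lemma marg_lr_weight v1 v2 : marg_l v1 * marg_r v2 * lr_weight v1 v2 =
  if atypical v1 v2 then 0 else P v1 v2.
Proof.
rewrite /lr_weight; case: ifP => _; first by rewrite mulr0.
have [h|h] := eqVneq (marg_l v1 * marg_r v2) 0.
  by rewrite h mul0r marg_mul_eq0.
by rewrite mulrC divfK.
Qed.

Lemma marg_lr_weight_le v1 v2 : marg_l v1 * marg_r v2 * lr_weight v1 v2 <= P v1 v2.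
Proof. by rewrite marg_lr_weight; case: ifP. Qed.

Lemma lr_weight_le v1 v2 : lr_weight v1 v2 <= t.
Proof.
rewrite /lr_weight; case: ifP => // /negbT; rewrite -leNgt => h.
have [e|n0] := eqVneq (marg_l v1 * marg_r v2) 0; first by rewrite e invr0 mulr0.
by rewrite ler_pdivrMr // lt_def n0 mulr_ge0 ?marg_l_ge0 ?marg_r_ge0.
Qed.

Lemma lr_weight_suml v1 : \sum_v2 marg_r v2 * lr_weight v1 v2 <= 1.
Proof.
have [h|h] := eqVneq (marg_l v1) 0.
  rewrite big1 // => v2 _; rewrite /lr_weight h mul0r invr0 mulr0.
  by rewrite if_same mulr0.
have h0 : 0 < marg_l v1 by rewrite lt_def h marg_l_ge0.
rewrite -(ler_pM2l h0) mulr1 mulr_sumr; apply: ler_sum => v2 _.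
by rewrite mulrA marg_lr_weight_le.
Qed.

Lemma lr_weight_sumr v2 : \sum_v1 marg_l v1 * lr_weight v1 v2 <= 1.
Proof.
have [h|h] := eqVneq (marg_r v2) 0.
  rewrite big1 // => v1 _; rewrite /lr_weight h mulr0 invr0 mulr0.
  by rewrite if_same mulr0.
have h0 : 0 < marg_r v2 by rewrite lt_def h marg_r_ge0.
rewrite -(ler_pM2l h0) mulr1 mulr_sumr; apply: ler_sum => v1 _.
by rewrite mulrCA mulrA marg_lr_weight_le.
Qed.

Definition prob_atypical := \sum_v1 \sum_(v2 | atypical v1 v2) P v1 v2.

(** Under independent draws the full likelihood ratio has mean 1; truncation costs exactly the
    probability of the atypical pairs. *)
Lemma lr_weight_mean :
  \sum_v1 marg_l v1 * \sum_v2 marg_r v2 * lr_weight v1 v2 = 1 - prob_atypical.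
Proof.
rewrite -P1 /prob_atypical -sumrB; apply: eq_bigr => v1 _.
rewrite [X in _ = X - _](bigID (atypical v1)) /= addrAC subrr add0r.
rewrite mulr_sumr [RHS]big_mkcond.
by apply: eq_bigr => v2 _; rewrite mulrA marg_lr_weight if_neg.
Qed.

Variables (C1 C2 : finType) (K1 K2 : nat) (f1 : 'I_K1 -> C1) (f2 : 'I_K2 -> C2).
Hypothesis f1_inj : injective f1.
Hypothesis f2_inj : injective f2.
Hypothesis K1_gt0 : (0 < K1)%N.
Hypothesis K2_gt0 : (0 < K2)%N.

(** [f1] and [f2] embed the two lists of one message pair into the whole codebooks. *)
Definition codebook_weight (c1 : {ffun C1 -> V1}) (c2 : {ffun C2 -> V2}) : R :=
  (K1 * K2)%:R^-1 * \sum_k1 \sum_k2 lr_weight (c1 (f1 k1)) (c2 (f2 k2)).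

(** Distinct indices give independent codewords. With at most one index shared, the partial means of
    the weight, which are at most 1, bound the moment by 1; with both shared, truncation gives
    $w^2\le tw$, hence the bound [t]. *)
Lemma pair_moment k1 k2 l1 l2 :
  \sum_(c1 : {ffun C1 -> V1}) prodw marg_l c1 * (\sum_(c2 : {ffun C2 -> V2})
    prodw marg_r c2 * (lr_weight (c1 (f1 k1)) (c2 (f2 k2)) *
                       lr_weight (c1 (f1 l1)) (c2 (f2 l2)))) <=
  1 + (k1 == l1)%:R + (k2 == l2)%:R + t * ((k1 == l1)%:R * (k2 == l2)%:R).
Proof.
have w0 := lr_weight_ge0; have m0 := marg_l_ge0; have n0 := marg_r_ge0.
pose g v v' := if k2 == l2 then \sum_x marg_r x * (lr_weight v x * lr_weight v' x)
  else \sum_x marg_r x * \sum_y marg_r y * (lr_weight v x * lr_weight v' y).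
rewrite (eq_bigr (fun c1 : {ffun C1 -> V1} => prodw marg_l c1 * g (c1 (f1 k1)) (c1 (f1 l1)))); last first.
  move=> c1 _; congr (_ * _).
  rewrite (@expect_pair _ _ _ _ _ _ (fun x y =>
    lr_weight (c1 (f1 k1)) x * lr_weight (c1 (f1 l1)) y) marg_r_sum).
  by rewrite (inj_eq f2_inj).
rewrite expect_pair ?marg_l_sum // (inj_eq f1_inj) /g.
have sep v v' : \sum_x marg_r x * \sum_y marg_r y * (lr_weight v x * lr_weight v' y)
    = (\sum_x marg_r x * lr_weight v x) * (\sum_y marg_r y * lr_weight v' y).
  rewrite mulr_suml; apply: eq_bigr => x _; rewrite -mulrA; congr (_ * _).
  by rewrite mulr_sumr; apply: eq_bigr => y _; rewrite mulrCA.
have s0 v : 0 <= \sum_x marg_r x * lr_weight v x.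
  by apply: sumr_ge0 => x _; rewrite mulr_ge0.
have s1 := lr_weight_suml.
case: eqP => _ /=; case: eqP => _ /=; rewrite ?mulr1 ?mulr0 ?addr0.
- rewrite [leRHS]addrC -[leLHS]addr0; apply: lerD; last by rewrite !addr_ge0.
  apply: (@le_trans _ _ (t * \sum_j marg_l j)); last by rewrite marg_l_sum mulr1.
  rewrite mulr_sumr; apply: ler_sum => v _; rewrite [leRHS]mulrC ler_wpM2l //.
  apply: (@le_trans _ _ (t * \sum_x marg_r x * lr_weight v x)).
    rewrite mulr_sumr; apply: ler_sum => x _; rewrite mulrCA.
    by apply: ler_wpM2r; rewrite ?mulr_ge0 // lr_weight_le.
  by rewrite -[leRHS]mulr1 ler_wpM2l.
- rewrite -[leLHS]addr0; apply: lerD => //; rewrite -marg_l_sum; apply: ler_sum => v _.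
  by rewrite sep ler_piMr // mulr_ile1.
- rewrite -[leLHS]addr0; apply: lerD => //.
  rewrite [leLHS](_ : _ = \sum_x marg_r x * ((\sum_v marg_l v * lr_weight v x) *
      (\sum_v' marg_l v' * lr_weight v' x))).
    rewrite -marg_r_sum; apply: ler_sum => x _; rewrite ler_piMr // mulr_ile1 ?lr_weight_sumr //;
    by apply: sumr_ge0 => v _; rewrite mulr_ge0.
  under eq_bigr do under eq_bigr do rewrite mulr_sumr.
  under eq_bigr do rewrite exchange_big /= mulr_sumr.
  rewrite exchange_big; apply: eq_bigr => x _ /=.
  rewrite [X in _ = _ * X]mulr_suml [RHS]mulr_sumr; apply: eq_bigr => v _ /=.
  rewrite !mulr_sumr; apply: eq_bigr => v' _; ring.
- rewrite -marg_l_sum; apply: ler_sum => v _; rewrite ler_piMr //.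
  rewrite -marg_l_sum; apply: ler_sum => v' _; rewrite ler_piMr //.
  by rewrite sep mulr_ile1.
Qed.

(** The square is expanded. The mean of the weight is [1 - prob_atypical], and summing [pair_moment]
    counts coincidences of indices, which yields the three inverse terms. The constants 1 - 2 + 1
    cancel. *)
Lemma codebook_weight_deviation :
  \sum_c1 prodw marg_l c1 * (\sum_c2 prodw marg_r c2 * (1 - codebook_weight c1 c2) ^+ 2)
  <= 2 * prob_atypical + K1%:R^-1 + K2%:R^-1 + t / (K1 * K2)%:R.
Proof.
have k10 : 0 < K1%:R :> R by rewrite ltr0n.
have k20 : 0 < K2%:R :> R by rewrite ltr0n.
pose E (F : {ffun C1 -> V1} -> {ffun C2 -> V2} -> R) :=
  \sum_c1 \sum_c2 prodw marg_l c1 * (prodw marg_r c2 * F c1 c2).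
have EE F : E F = \sum_c1 prodw marg_l c1 * (\sum_c2 prodw marg_r c2 * F c1 c2).
  by apply: eq_bigr => c1 _; rewrite mulr_sumr.
rewrite -(EE (fun c1 c2 => (1 - codebook_weight c1 c2) ^+ 2)).
have ED F G : E (fun c1 c2 => F c1 c2 + G c1 c2) = E F + E G.
  rewrite /E -big_split; apply: eq_bigr => c1 _ /=; rewrite -big_split /=.
  by apply: eq_bigr => c2 _; rewrite !mulrDr.
have EZ a F : E (fun c1 c2 => a * F c1 c2) = a * E F.
  rewrite /E mulr_sumr; apply: eq_bigr => c1 _; rewrite mulr_sumr.
  by apply: eq_bigr => c2 _; ring.
have ES (T : finType) (F : T -> {ffun C1 -> V1} -> {ffun C2 -> V2} -> R) :
    E (fun c1 c2 => \sum_i F i c1 c2) = \sum_i E (F i).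
  rewrite /E [RHS]exchange_big; apply: eq_bigr => c1 _ /=.
  rewrite [RHS]exchange_big; apply: eq_bigr => c2 _ /=.
  by rewrite !mulr_sumr.
have EX F G : (forall c1 c2, F c1 c2 = G c1 c2) -> E F = E G.
  by move=> FG; apply: eq_bigr => c1 _; apply: eq_bigr => c2 _; rewrite FG.
have E1 : E (fun _ _ => 1) = 1.
  rewrite EE; under eq_bigr do under eq_bigr do rewrite mulr1.
  under eq_bigr do rewrite (prodw_sum _ marg_r_sum) mulr1.
  exact: (prodw_sum _ marg_l_sum).
have EW : E codebook_weight = 1 - prob_atypical.
  rewrite (EZ _ (fun c1 c2 => \sum_k1 \sum_k2 lr_weight (c1 (f1 k1)) (c2 (f2 k2)))).
  rewrite ES; under eq_bigr do rewrite ES.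
  rewrite (eq_bigr (fun=> \sum_(k2 < K2) (1 - prob_atypical))); last first.
    move=> k1 _; apply: eq_bigr => k2 _; rewrite EE -lr_weight_mean.
    rewrite -(@expect_one _ _ _ marg_l (f1 k1) (fun v => \sum_v2 marg_r v2 * lr_weight v v2) marg_l_sum).
    apply: eq_bigr => c1 _.
    by rewrite (@expect_one _ _ _ marg_r (f2 k2) (lr_weight (c1 (f1 k1))) marg_r_sum).
  rewrite !sumr_const !card_ord -mulrnA [(K2 * K1)%N]mulnC.
  rewrite -[X in _ * X]mulr_natl mulKf //.
  by rewrite natrM mulf_neq0 ?gt_eqF.
have EWW : E (fun c1 c2 => codebook_weight c1 c2 ^+ 2) <=
    1 + K1%:R^-1 + K2%:R^-1 + t / (K1 * K2)%:R.
  rewrite (EX _ (fun c1 c2 => (K1 * K2)%:R^-1 ^+ 2 *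
    \sum_k1 \sum_k2 \sum_l1 \sum_l2 (lr_weight (c1 (f1 k1)) (c2 (f2 k2)) *
                       lr_weight (c1 (f1 l1)) (c2 (f2 l2))))); last first.
    move=> c1 c2; rewrite /codebook_weight exprMn; congr (_ * _).
    rewrite expr2 mulr_suml; apply: eq_bigr => k1 _.
    rewrite mulr_suml; apply: eq_bigr => k2 _.
    rewrite mulr_sumr; apply: eq_bigr => l1 _.
    by rewrite mulr_sumr.
  rewrite EZ ES; under eq_bigr do rewrite ES.
  under eq_bigr do under eq_bigr do rewrite ES.
  under eq_bigr do under eq_bigr do under eq_bigr do rewrite ES.
  apply: (@le_trans _ _ ((K1 * K2)%:R^-1 ^+ 2 *
    \sum_(k1 < K1) \sum_(k2 < K2) \sum_(l1 < K1) \sum_(l2 < K2)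
     (1 + (k1 == l1)%:R + (k2 == l2)%:R + t * ((k1 == l1)%:R * (k2 == l2)%:R)))).
    apply: ler_wpM2l; first by rewrite exprn_ge0 // invr_ge0.
    do 4 (apply: ler_sum => ? _); rewrite EE; exact: pair_moment.
  have d (K : nat) (k : 'I_K) : \sum_(l < K) (k == l)%:R = 1 :> R.
    rewrite (bigD1 k) //= eqxx big1 ?addr0 // => l; rewrite eq_sym.
    by move=> /negbTE ->.
  have sumc (K : nat) (x : R) : \sum_(l < K) x = K%:R * x.
    by rewrite sumr_const card_ord mulr_natl.
  have inner (k1 : 'I_K1) (k2 : 'I_K2) : \sum_(l1 < K1) \sum_(l2 < K2)
     (1 + (k1 == l1)%:R + (k2 == l2)%:R + t * ((k1 == l1)%:R * (k2 == l2)%:R))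
     = K1%:R * K2%:R + K2%:R + K1%:R + t :> R.
    transitivity (\sum_(l1 < K1) ((1 + (k1 == l1)%:R) * K2%:R + 1 + t * (k1 == l1)%:R)).
      apply: eq_bigr => l1 _; rewrite !big_split /= d -!mulr_sumr d !sumc; ring.
    rewrite !big_split /= -mulr_suml -mulr_sumr big_split /= d !sumc; ring.
  under eq_bigr do under eq_bigr do rewrite inner.
  rewrite !sumc !natrM.
  rewrite le_eqVlt; apply/orP; left; apply/eqP; field.
  by rewrite !gt_eqF.
rewrite (EX _ (fun c1 c2 => (1 + (- 2) * codebook_weight c1 c2) + codebook_weight c1 c2 ^+ 2)).
  by rewrite ED ED E1 EZ EW; lra.
by move=> c1 c2; ring.
Qed.

End Covering.
End OneShotMarton.

(** * One-shot coding for the broadcast channel *)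

Section OneShotBroadcast.
Variable R : realType.
Implicit Types (I J : finType).

Lemma psd_add I (A B : Op R I) : psd A -> psd B -> psd (fun i j => A i j + B i j).
Proof.
move=> pA pB; apply/(psdE _) => v.
rewrite (_ : qf _ v = qf A v + qf B v); first by rewrite addr_ge0 //; apply: (psdE _).1.
rewrite /qf -big_split; apply: eq_bigr => i _ /=.
by rewrite -big_split; apply: eq_bigr => j _ /=; rewrite mulrDr mulrDl.
Qed.

Lemma povm_compl_psd I (M : finType) (D : M -> Op R I) m :
  povm D -> psd (opsub (@opid R I) (D m)).
Proof.
case=> pD D1; suff -> : opsub (@opid R I) (D m) = fun i j => \sum_(m' | m' != m) D m' i j.
  by apply: psd_sum.
apply/funext => i; apply/funext => j.
by rewrite /opsub -D1 (bigD1 m) //= addrAC subrr add0r.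
Qed.

Lemma optens_opid I J : optens (@opid R I) (@opid R J) = @opid R (I * J)%type.
Proof.
apply/funext => a; apply/funext => b; rewrite /optens /opid -natrM mulnb.
by case: a => a1 a2; case: b.
Qed.

Lemma rtrD I (A B S : Op R I) :
  rtr (fun i j => A i j + B i j) S = rtr A S + rtr B S.
Proof.
rewrite /rtr -ReD /optr /opmul -big_split; congr complex.Re.
apply: eq_bigr => i _ /=; rewrite -big_split; apply: eq_bigr => j _ /=.
by rewrite mulrDl.
Qed.

Lemma rtr_psd_ge0 I (A S : Op R I) : psd A -> psd S -> 0 <= rtr A S.
Proof. by move=> pA pS; have := optr_psd_ge0 pA pS; rewrite lecE => /andP[]. Qed.

Lemma rtr_opid I (S : Op R I) : rtr (@opid R I) S = complex.Re (optr S).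
Proof.
congr complex.Re; apply: eq_bigr => i _.
rewrite -(sum_delta i (fun k => S k i)); apply: eq_bigr => k _.
by rewrite /opid eq_sym.
Qed.

Lemma rtr_ptr2 I J (A : Op R I) (S : Op R (I * J)%type) :
  rtr (optens A (@opid R J)) S = rtr A (ptr2 S).
Proof.
congr complex.Re; rewrite /optr /opmul /optens /ptr2.
rewrite sum_pair /=.
apply: eq_bigr => i _; under [RHS]eq_bigr do rewrite mulr_sumr.
rewrite [RHS]exchange_big; apply: eq_bigr => j _ /=.
rewrite sum_pair /=.
apply: eq_bigr => k _; rewrite -(sum_delta j (fun l => A i k * S (k, l) (i, j))).
by apply: eq_bigr => l _; rewrite /opid eq_sym; ring.
Qed.

Lemma rtr_ptr1 I J (B : Op R J) (S : Op R (I * J)%type) :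
  rtr (optens (@opid R I) B) S = rtr B (ptr1 S).
Proof.
congr complex.Re; rewrite /optr /opmul /optens /ptr1.
rewrite sum_pair /=.
rewrite exchange_big; apply: eq_bigr => j _ /=.
under [RHS]eq_bigr do rewrite mulr_sumr.
rewrite [RHS]exchange_big; apply: eq_bigr => i _ /=.
rewrite sum_pair /=.
rewrite exchange_big /=; apply: eq_bigr => l _.
rewrite -(sum_delta i (fun k => B j l * S (k, l) (i, j))).
by apply: eq_bigr => k _; rewrite /opid eq_sym; ring.
Qed.

Section BroadcastError.
Variables (I J M N : finType) (D1 : M -> Op R I) (D2 : N -> Op R J).
Variables (S : Op R (I * J)%type) (m : M) (n : N).
Hypotheses (D1p : povm D1) (D2p : povm D2) (Sd : density S).
Let err := opsub (@opid R (I * J)%type) (optens (D1 m) (D2 n)).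
Let A' := opsub (@opid R I) (D1 m).
Let B' := opsub (@opid R J) (D2 n).

(** $I-A\otimes B=(I-A)\otimes I+A\otimes(I-B)$, a sum of positive operators. *)
Lemma broadcast_error_psd : psd err.
Proof.
have pA := povm_compl_psd m D1p; have pB := povm_compl_psd n D2p.
suff -> : err = fun a b => optens A' (@opid R J) a b + optens (D1 m) B' a b.
  by apply: psd_add; apply: psd_optens => //; [exact: psd_opid | case: D1p].
apply/funext => a; apply/funext => b.
by rewrite /err -optens_opid /opsub /optens /A' /B' /opsub; ring.
Qed.

Lemma broadcast_error_le1 : rtr err S <= 1.
Proof.
case: Sd => pS tS.
have -> : 1 = rtr (@opid R _) S by rewrite rtr_opid tS.
rewrite [leRHS](_ : _ = rtr err S + rtr (optens (D1 m) (D2 n)) S).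
  rewrite lerDl; apply: rtr_psd_ge0 => //; case: D1p => p1 _; case: D2p => p2 _.
  exact: psd_optens.
rewrite -rtrD; congr rtr; apply/funext => a; apply/funext => b.
by rewrite /err /opsub subrK.
Qed.

(** The two sides differ by the expectation of $(I-A)\otimes(I-B)$, which is positive. *)
Lemma broadcast_error_le : rtr err S <= rtr A' (ptr2 S) + rtr B' (ptr1 S).
Proof.
case: Sd => pS _; rewrite -rtr_ptr2 -rtr_ptr1 -rtrD.
set L := fun _ _ => _; have -> : L = fun a b => err a b + optens A' B' a b.
  apply/funext => a; apply/funext => b.
  by rewrite /L /err -optens_opid /opsub /optens /A' /B' /opsub; ring.
rewrite rtrD lerDl; apply: rtr_psd_ge0 => //.
by apply: psd_optens; apply: povm_compl_psd.
Qed.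

End BroadcastError.

Lemma exists_le_mean (T : finType) (w F : T -> R) (B : R) :
  (forall t, 0 <= w t) -> \sum_t w t = 1 -> \sum_t w t * F t <= B ->
  exists t, F t <= B.
Proof.
move=> w0 w1 FB; apply: contrapT => /forallNP h.
have {}h t : B < F t by rewrite ltNge; apply/negP.
have s0 : \sum_t w t * (F t - B) = 0.
  apply/eqP; rewrite eq_le; apply/andP; split.
    under eq_bigr do rewrite mulrBr.
    by rewrite sumrB -mulr_suml w1 mul1r subr_le0.
  by apply: sumr_ge0 => t _; rewrite mulr_ge0 // subr_ge0 ltW.
have z t : w t = 0.
  have nn i : true -> 0 <= w i * (F i - B) by rewrite mulr_ge0 // subr_ge0 ltW.
  have /(_ t isT)/eqP := psumr_eq0P nn s0.
  by rewrite mulf_eq0 subr_eq0 (gt_eqF (h t)) orbF => /eqP.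
by move: w1; rewrite big1 // => /eqP; rewrite eq_sym oner_eq0.
Qed.

(** The inequality $|u|\le s+u^2/(4s)$ trades the deviation of the total weight for its square,
    which the covering estimate controls. *)
Lemma amgm_deviation (e u s : R) : 0 <= e <= 1 -> 0 < s ->
  e * u <= s + u ^+ 2 / (4 * s).
Proof.
move=> /andP[e0 e1] s0.
have h : `|u| <= s + u ^+ 2 / (4 * s).
  have -> : s + u ^+ 2 / (4 * s) = (4 * s ^+ 2 + `|u| ^+ 2) / (4 * s).
    by rewrite -normrX ger0_norm ?sqr_ge0 //; field; rewrite gt_eqF.
  rewrite ler_pdivlMr ?mulr_gt0 // -subr_ge0.
  rewrite (_ : _ - _ = (2 * s - `|u|) ^+ 2) ?sqr_ge0 //; ring.
apply: le_trans h; apply: (le_trans (ler_norm _)).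
by rewrite normrM (ger0_norm e0) ler_piMl.
Qed.

Variables (V1 V2 J1 J2 : finType) (P : V1 -> V2 -> R).
Variable tau : V1 -> V2 -> Op R (J1 * J2)%type.
Hypothesis P0 : forall v1 v2, 0 <= P v1 v2.
Hypothesis P1 : \sum_v1 \sum_v2 P v1 v2 = 1.
Hypothesis taud : forall v1 v2, density (tau v1 v2).

(** It is not divided by the marginal, so that its trace is [marg_l P v1], the form that
    [good_decoder] takes. *)
Definition state_l v1 : Op R J1 := fun i j => \sum_v2 (P v1 v2)%:C * ptr2 (tau v1 v2) i j.
Definition state_r v2 : Op R J2 := fun i j => \sum_v1 (P v1 v2)%:C * ptr1 (tau v1 v2) i j.

Lemma rtr_state_l A v1 : rtr A (state_l v1) = \sum_v2 P v1 v2 * rtr A (ptr2 (tau v1 v2)).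
Proof.
under eq_bigr do rewrite /rtr -ReZ; rewrite -Re_sum; congr complex.Re.
under [RHS]eq_bigr do rewrite /optr mulr_sumr.
rewrite [RHS]exchange_big; apply: eq_bigr => i _ /=.
under [RHS]eq_bigr do rewrite /opmul mulr_sumr.
rewrite [RHS]exchange_big; apply: eq_bigr => j _ /=.
by rewrite /state_l mulr_sumr; apply: eq_bigr => v2 _; rewrite mulrCA.
Qed.

Lemma rtr_state_r A v2 : rtr A (state_r v2) = \sum_v1 P v1 v2 * rtr A (ptr1 (tau v1 v2)).
Proof.
under eq_bigr do rewrite /rtr -ReZ; rewrite -Re_sum; congr complex.Re.
under [RHS]eq_bigr do rewrite /optr mulr_sumr.
rewrite [RHS]exchange_big; apply: eq_bigr => i _ /=.
under [RHS]eq_bigr do rewrite /opmul mulr_sumr.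
rewrite [RHS]exchange_big; apply: eq_bigr => j _ /=.
by rewrite /state_r mulr_sumr; apply: eq_bigr => v2' _; rewrite mulrCA.
Qed.

(** [e1 + e2] bounds the likelihood-weighted errors of the two receivers; the rest pays for a total
    weight of the lists different from 1, with [s] the parameter of [amgm_deviation]. *)
Lemma oneshot_marton (M1 K1 M2 K2 : nat) (e1 e2 t s : R) :
  (0 < M1)%N -> (0 < K1)%N -> (0 < M2)%N -> (0 < K2)%N -> 0 <= t -> 0 < s ->
  good_decoder (marg_l P) state_l M1 K1 e1 ->
  good_decoder (marg_r P) state_r M2 K2 e2 ->
  exists (x : 'I_M1 -> 'I_M2 -> V1 * V2) (D1 : 'I_M1 -> Op R J1) (D2 : 'I_M2 -> Op R J2),
  [/\ povm D1, povm D2 &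
    (M1 * M2)%:R^-1 * (\sum_m1 \sum_m2
     rtr (opsub (@opid R (J1 * J2)%type) (optens (D1 m1) (D2 m2)))
         (tau (x m1 m2).1 (x m1 m2).2))
    <= e1 + e2 + (s + (2 * prob_atypical P t + K1%:R^-1 + K2%:R^-1 + t / (K1 * K2)%:R)
       / (4 * s))].
Proof.
move=> M1_gt0 K1_gt0 M2_gt0 K2_gt0 t0 s0 [D1 [D1p D1e]] [D2 [D2p D2e]].
set B := e1 + e2 + _.
pose err (c1 : {ffun 'I_M1 * 'I_K1 -> V1}) (c2 : {ffun 'I_M2 * 'I_K2 -> V2}) m1 m2
    (k : 'I_K1 * 'I_K2) :=
  rtr (opsub (@opid R (J1 * J2)%type) (optens (D1 c1 m1) (D2 c2 m2)))
      (tau (c1 (m1, k.1)) (c2 (m2, k.2))).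
have err01 c1 c2 m1 m2 k : 0 <= err c1 c2 m1 m2 k <= 1.
  apply/andP; split; last exact: broadcast_error_le1.
  by apply: rtr_psd_ge0; [exact: broadcast_error_psd | case: (taud (c1 (m1, k.1)) (c2 (m2, k.2)))].
have best c1 c2 m1 m2 : exists k, forall k', err c1 c2 m1 m2 k <= err c1 c2 m1 m2 k'.
  have k0 : 'I_K1 * 'I_K2 := (Ordinal K1_gt0, Ordinal K2_gt0).
  case: (@arg_minP _ _ _ k0 predT (err c1 c2 m1 m2) isT) => k _ kmin.
  by exists k => k'; apply: kmin.
(* The encoder picks the pair of least error, which is at most the average of
   the errors for any weights of total mass 1, hence nearly so for [w]. *)
pose k c1 c2 m1 m2 := xget (Ordinal K1_gt0, Ordinal K2_gt0)
  [set k | forall k', err c1 c2 m1 m2 k <= err c1 c2 m1 m2 k']%classic.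
have kP c1 c2 m1 m2 k' : err c1 c2 m1 m2 (k c1 c2 m1 m2) <= err c1 c2 m1 m2 k'.
  by rewrite /k; case: xgetP => [y _ ->//|]; case: (best c1 c2 m1 m2) => y hy /(_ y).
pose w := lr_weight P t.
pose W m1 m2 c1 c2 := codebook_weight P t (fun k1 : 'I_K1 => (m1, k1) : 'I_M1 * 'I_K1)
  (fun k2 : 'I_K2 => (m2, k2) : 'I_M2 * 'I_K2) c1 c2.
have w0 v1 v2 : 0 <= w v1 v2 by apply: lr_weight_ge0.
have l0 := marg_l_ge0 P0; have r0 := marg_r_ge0 P0.
have l1 := marg_l_sum P1; have r1 := marg_r_sum P1.
have KK : 0 < (K1 * K2)%:R :> R by rewrite ltr0n muln_gt0 K1_gt0.
pose E (F : {ffun 'I_M1 * 'I_K1 -> V1} -> {ffun 'I_M2 * 'I_K2 -> V2} -> R) :=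
  \sum_c1 \sum_c2 prodw (marg_l P) c1 * prodw (marg_r P) c2 * F c1 c2.
have ED F G : E (fun c1 c2 => F c1 c2 + G c1 c2) = E F + E G.
  rewrite /E -big_split; apply: eq_bigr => c1 _ /=; rewrite -big_split /=.
  by apply: eq_bigr => c2 _; rewrite mulrDr.
have EZ a F : E (fun c1 c2 => a * F c1 c2) = a * E F.
  rewrite /E mulr_sumr; apply: eq_bigr => c1 _; rewrite mulr_sumr.
  by apply: eq_bigr => c2 _; rewrite mulrCA.
have ES (T : finType) (F : T -> _ -> _ -> R) :
    E (fun c1 c2 => \sum_i F i c1 c2) = \sum_i E (F i).
  rewrite /E [RHS]exchange_big; apply: eq_bigr => c1 _ /=.
  rewrite [RHS]exchange_big; apply: eq_bigr => c2 _ /=.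
  by rewrite !mulr_sumr.
have Ele F G : (forall c1 c2, F c1 c2 <= G c1 c2) -> E F <= E G.
  move=> FG; apply: ler_sum => c1 _; apply: ler_sum => c2 _.
  by apply: ler_wpM2l => //; rewrite mulr_ge0 ?prodw_ge0.
have E1 : E (fun _ _ => 1) = 1.
  rewrite /E; under eq_bigr do under eq_bigr do rewrite mulr1.
  under eq_bigr do rewrite -mulr_sumr (prodw_sum _ r1) mulr1.
  exact: prodw_sum.
(* The marginals times the weight are at most [P], so the pair behaves as if drawn jointly. The
   error then splits, and summing out the codebook of the other receiver leaves [state_l] or
   [state_r], that is, a point-to-point decoding error. *)
have cell m1 m2 kk : E (fun c1 c2 =>
    w (c1 (m1, kk.1)) (c2 (m2, kk.2)) * err c1 c2 m1 m2 kk) <= e1 + e2.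
  case: kk => k1 k2 /=.
  set j1 := (m1, k1); set j2 := (m2, k2).
  pose p1' (c1 : {ffun 'I_M1 * 'I_K1 -> V1}) := \prod_(j | j != j1) marg_l P (c1 j).
  pose p2' (c2 : {ffun 'I_M2 * 'I_K2 -> V2}) := \prod_(j | j != j2) marg_r P (c2 j).
  have p1'0 c1 : 0 <= p1' c1 by apply: prodr_ge0.
  have p2'0 c2 : 0 <= p2' c2 by apply: prodr_ge0.
  pose g1 c1 v1 v2 := rtr (opsub (@opid R J1) (D1 c1 m1)) (ptr2 (tau v1 v2)).
  pose g2 c2 v1 v2 := rtr (opsub (@opid R J2) (D2 c2 m2)) (ptr1 (tau v1 v2)).
  apply: (@le_trans _ _ (\sum_c1 \sum_c2 p1' c1 * (p2' c2 * (P (c1 j1) (c2 j2) *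
     (g1 c1 (c1 j1) (c2 j2) + g2 c2 (c1 j1) (c2 j2)))))).
    apply: ler_sum => c1 _; apply: ler_sum => c2 _.
    rewrite (prodwD1 _ j1) (prodwD1 _ j2) -/(p1' c1) -/(p2' c2).
    rewrite [leLHS](_ : _ = p1' c1 * (p2' c2 * ((marg_l P (c1 j1) * marg_r P (c2 j2)
       * w (c1 j1) (c2 j2)) * err c1 c2 m1 m2 (k1, k2)))); last by ring.
    apply: ler_wpM2l => //; apply: ler_wpM2l => //.
    have /andP[er0 _] := err01 c1 c2 m1 m2 (k1, k2).
    apply: ler_pM => //; [by rewrite mulr_ge0 ?mulr_ge0 | exact: marg_lr_weight_le |].
    exact: broadcast_error_le.
  under eq_bigr do under eq_bigr do rewrite mulrDr !mulrDr.
  under eq_bigr do rewrite big_split /=; rewrite big_split /=; apply: lerD.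
    apply: le_trans (D1e m1 k1); apply: ler_sum => c1 _.
    rewrite -mulr_sumr (marginal1 j2 (fun v2 => P (c1 j1) v2 * g1 c1 (c1 j1) v2) r1).
    by rewrite rtr_state_l.
  apply: le_trans (D2e m2 k2); rewrite exchange_big /=; apply: ler_sum => c2 _.
  rewrite (eq_bigr (fun c1 : {ffun 'I_M1 * 'I_K1 -> V1} =>
    p2' c2 * (p1' c1 * (P (c1 j1) (c2 j2) * g2 c2 (c1 j1) (c2 j2))))); last first.
    by move=> c1 _; rewrite mulrCA.
  rewrite -mulr_sumr (marginal1 j1 (fun v1 => P v1 (c2 j2) * g2 c2 v1 (c2 j2)) l1).
  by rewrite rtr_state_r.
have message m1 m2 : E (fun c1 c2 => err c1 c2 m1 m2 (k c1 c2 m1 m2)) <= B.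
  apply: (@le_trans _ _ (E (fun c1 c2 => (K1 * K2)%:R^-1 *
    (\sum_kk w (c1 (m1, kk.1)) (c2 (m2, kk.2)) * err c1 c2 m1 m2 kk)
    + (s * 1 + (4 * s)^-1 * (1 - W m1 m2 c1 c2) ^+ 2)))).
    apply: Ele => c1 c2; set e := err c1 c2 m1 m2 _.
    (* By minimality of [k], the error times the total weight is at most the weighted average of all
       errors; [amgm_deviation] bounds the remainder. *)
    have -> : e = e * W m1 m2 c1 c2 + e * (1 - W m1 m2 c1 c2) by ring.
    apply: lerD; last first.
      by rewrite mulr1 [(4 * s)^-1 * _]mulrC; apply: amgm_deviation => //; exact: err01.
    rewrite /W /codebook_weight mulrCA; apply: ler_wpM2l.
      by rewrite invr_ge0 ltW.
    rewrite mulr_sumr (eq_bigr (fun k1 => \sum_k2 e * w (c1 (m1, k1)) (c2 (m2, k2)))).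
      rewrite pair_bigA; apply: ler_sum => kk _ /=; rewrite mulrC.
      by apply: ler_wpM2l => //; apply: kP.
    by move=> k1 _; rewrite mulr_sumr.
  rewrite ED EZ ES ED (EZ s) E1 mulr1 EZ /B lerD //.
    rewrite ler_pdivrMl //; apply: (le_trans (ler_sum _ (fun kk _ => cell m1 m2 kk))).
    by rewrite sumr_const card_prod !card_ord -[_ *+ _]mulr_natl.
  rewrite lerD2l mulrC; apply: ler_wpM2r; first by rewrite invr_ge0 mulr_ge0 // ltW.
  rewrite [leLHS](_ : _ = \sum_c1 prodw (marg_l P) c1 * (\sum_c2 prodw (marg_r P) c2 *
    (1 - W m1 m2 c1 c2) ^+ 2)).
    by apply: codebook_weight_deviation => // ? ? [].
  apply: eq_bigr => c1 _; rewrite mulr_sumr; apply: eq_bigr => c2 _.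
  by rewrite mulrA.
(* The error is averaged over messages before the codebooks are fixed, so that one pair of codebooks
   serves all message pairs. *)
pose F (c : {ffun 'I_M1 * 'I_K1 -> V1} * {ffun 'I_M2 * 'I_K2 -> V2}) :=
  (M1 * M2)%:R^-1 * \sum_m1 \sum_m2 err c.1 c.2 m1 m2 (k c.1 c.2 m1 m2).
have [|||[c1 c2] Fc] := @exists_le_mean _
  (fun c => prodw (marg_l P) c.1 * prodw (marg_r P) c.2) F B.
- by move=> c; rewrite mulr_ge0 ?prodw_ge0.
- rewrite sum_pair /=.
  by rewrite -[RHS]E1; apply: eq_bigr => c1 _; apply: eq_bigr => c2 _; rewrite mulr1.
- rewrite sum_pair /=.
  rewrite -/(E (fun c1 c2 => F (c1, c2))) /F EZ /= ES; under eq_bigr do rewrite ES.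
  have MM : 0 < (M1 * M2)%:R :> R by rewrite ltr0n muln_gt0 M1_gt0.
  rewrite ler_pdivrMl //.
  apply: (@le_trans _ _ (\sum_(m1 < M1) \sum_(m2 < M2) B)).
    by apply: ler_sum => m1 _; apply: ler_sum => m2 _.
  by rewrite !sumr_const !card_ord -mulrnA [(M2 * M1)%N]mulnC -[leLHS]mulr_natl.
exists (fun m1 m2 => (c1 (m1, (k c1 c2 m1 m2).1), c2 (m2, (k c1 c2 m1 m2).2))).
by exists (D1 c1), (D2 c2); split => //; exact: Fc.
Qed.

End OneShotBroadcast.

(** * Many uses of the channel *)

Section Asymptotics.
Variable R : realType.
Implicit Types (I J U : finType).
Local Notation "z ^*" := (cconj z) : ring_scope.

Lemma pow2_small (d e : R) : 0 < d -> 0 < e ->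
  exists N : nat, forall n : nat, (N <= n)%N -> 2 `^ (- (n%:R * d)) <= e.
Proof.
move=> d0 e0.
have l2 : 0 < ln (2 : R) by rewrite ln_gt0 // ltr1n.
have dl : 0 < d * ln 2 by rewrite mulr_gt0.
pose N := Num.bound (e^-1 / (d * ln 2)).
have HN : e^-1 / (d * ln 2) < N%:R.
  by apply: archi_boundP; rewrite divr_ge0 ?invr_ge0 ?ltW.
exists N => n Nn; rewrite pow2N -[leRHS]invrK lef_pV2 ?posrE ?invr_gt0 ?pow2_gt0 //.
rewrite /powR pnatr_eq0 /= -mulrA.
apply: le_trans (expR_ge1Dx _).
apply: (@le_trans _ _ (n%:R * (d * ln 2))); last by rewrite lerDr.
rewrite -ler_pdivrMr //; apply: (le_trans (ltW HN)); by rewrite ler_nat.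
Qed.

Lemma sum_ffun_pair (V : nmodType) (K I J : finType) (F : {ffun K -> I * J} -> V) :
  \sum_w F w = \sum_(u : {ffun K -> I}) \sum_(v : {ffun K -> J})
    F [ffun k => (u k, v k)].
Proof.
rewrite pair_bigA /=.
rewrite (reindex (fun p : {ffun K -> I} * {ffun K -> J} => [ffun k => (p.1 k, p.2 k)])) //=.
exists (fun w : {ffun K -> I * J} => ([ffun k => (w k).1], [ffun k => (w k).2])).
  by case=> u v _ /=; congr pair; apply/ffunP => k; rewrite !ffunE.
by move=> w _; apply/ffunP => k; rewrite !ffunE; case: (w k).
Qed.

(** Eigenvalues multiply along the letters, so that thresholds on eigenvalues become events on
    products along a sequence. *)
Lemma diagform_tensor (K I : finType) (S U : K -> Op R I) (mu : K -> I -> R) :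
  (forall k, diagform (U k) (mu k) (S k)) ->
  diagform (fun (a i : {ffun K -> I}) => \prod_k U k (a k) (i k))
    (fun i : {ffun K -> I} => \prod_k mu k (i k))
    (fun a b : {ffun K -> I} => \prod_k S k (a k) (b k)).
Proof.
move=> dS; have uU k : unitary (U k) by case: (dS k).
have delta (a b : {ffun K -> I}) : \prod_k (a k == b k)%:R = (a == b)%:R :> R[i].
  have [->|/eqP ab] := eqVneq a b; first by rewrite big1 // => k _; rewrite eqxx.
  have [k abk] : exists k, a k != b k.
    by apply: contrapT => /forallNP h; apply: ab; apply/ffunP => k; apply/eqP/negPn/negP; apply: h.
  by rewrite (bigD1 k) //= (negbTE abk) mul0r.
split.
- split; apply/funext => a; apply/funext => b; rewrite /opmul /adj /opid -delta.
    rewrite (eq_bigr (fun i : {ffun K -> I} => \prod_k (U k (a k) (i k) * (U k (b k) (i k))^*))).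
      rewrite (@sum_ffun_prod _ _ _ (fun k i => U k (a k) i * (U k (b k) i)^*)).
      by apply: eq_bigr => k _; rewrite unitary_rowE.
    by move=> i _; rewrite -/(cconj _) cconj_prod big_split.
  rewrite (eq_bigr (fun i : {ffun K -> I} => \prod_k ((U k (i k) (a k))^* * U k (i k) (b k)))).
    rewrite (@sum_ffun_prod _ _ _ (fun k i => (U k i (a k))^* * U k i (b k))).
    by apply: eq_bigr => k _; rewrite unitary_colE.
  by move=> i _; rewrite -/(cconj _) cconj_prod big_split.
- move=> a b; under [RHS]eq_bigr do rewrite realc_prod cconj_prod -!big_split /=.
  rewrite (@sum_ffun_prod _ _ _ (fun k i => (mu k i)%:C * (U k (a k) i * (U k (b k) i)^*))).
  by apply: eq_bigr => k _; case: (dS k) => _ ->.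
- by move=> i; apply: prodr_ge0 => k _; case: (dS k) => _ _.
Qed.

Definition iid_state U I (s : U -> Op R I) n (u : {ffun 'I_n -> U}) : Op R {ffun 'I_n -> I} :=
  fun a b => \prod_k s (u k) (a k) (b k).

Lemma optr_iid_state U I (s : U -> Op R I) (q : U -> R) n (u : {ffun 'I_n -> U}) :
  (forall u, optr (s u) = (q u)%:C) -> optr (iid_state s u) = (prodw q u)%:C.
Proof.
move=> trs; rewrite /optr /iid_state (@sum_ffun_prod _ _ _ (fun k i => s (u k) i i)).
by rewrite realc_prod; apply: eq_bigr => k _; rewrite -trs.
Qed.

(** The exponent is $I(U;B)-3d$ written out as $H(U)+H(B)-H(UB)-3d$. The two thresholds have ratio
    $2^{-n(I(U;B)-2d)}$, which leaves $2^{-nd}$ for the interference. *)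
Lemma iid_packing U I (s : U -> Op R I) (q : U -> R) V mu W lam (d e : R) :
  (forall u, 0 <= q u) -> \sum_u q u = 1 -> (forall u, optr (s u) = (q u)%:C) ->
  (forall u, diagform (V u) (mu u) (s u)) ->
  diagform W lam (fun i j => \sum_u s u i j) -> 0 < d -> 0 < e ->
  exists N : nat, forall n : nat, (N <= n)%N -> forall M K : nat, (0 < M)%N ->
    (M * K)%:R <= 2 `^ (n%:R *
      (- \sum_u q u * log2 (q u) - \sum_i lam i * log2 (lam i)
       + \sum_u \sum_i mu u i * log2 (mu u i) - 3 * d)) ->
    good_decoder (@prodw R 'I_n U q) (@iid_state U I s n) M K e.
Proof.
move=> q0 q1 trs ds dW d0 e0.
have mu0 u i : 0 <= mu u i by case: (ds u).
have [_ _ lam0] := dW.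
have qE u : \sum_i mu u i = q u by apply: complexI; rewrite -trs (optr_diag (ds u)).
have lam1 : \sum_i lam i = 1.
  apply: complexI; rewrite -(optr_diag dW) /optr exchange_big /=.
  by rewrite -q1 realc_sum; apply: eq_bigr => u _; rewrite -trs.
(* The packing constants 9 + 8 + 4 = 21 stay below 32. *)
have e1 : 0 < e / 32 by rewrite divr_gt0.
have [N1 HN1] := iid_product_large (r := lam) lam0 lam1 (fun _ h => h) d0 e1.
(* The conditional entropy of the output given the letter: where [q u] is positive, [mu u i / q u]
   are the eigenvalues of the normalised state. *)
pose m := \sum_u \sum_i mu u i * (log2 (q u) - log2 (mu u i)).
have mE : m = \sum_u q u * log2 (q u) - \sum_u \sum_i mu u i * log2 (mu u i).
  rewrite /m -sumrB; apply: eq_bigr => u _; rewrite -qE mulr_suml -sumrB.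
  by apply: eq_bigr => i _; rewrite mulrBr.
have mu_le u i : mu u i <= q u by rewrite -qE (bigD1 i) //= lerDl sumr_ge0.
have [||||| N2 HN2] := @iid_product_large R (U * I)%type (fun o => mu o.1 o.2)
    (fun o => q o.1 / mu o.1 o.2) d (e / 32) => //.
- by rewrite sum_pair -q1; apply: eq_bigr => u _; rewrite -qE.
- by move=> o h; rewrite divr_gt0 // (lt_le_trans h).
have em : \sum_(o : U * I) mu o.1 o.2 * log2 (q o.1 / mu o.1 o.2) = m.
  rewrite sum_pair; apply: eq_bigr => u _; apply: eq_bigr => i _ /=.
  have [->|mn] := eqVneq (mu u i) 0; first by rewrite !mul0r.
  have mp : 0 < mu u i by rewrite lt_def mn mu0.
  have qp : 0 < q u by rewrite (lt_le_trans mp).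
  by rewrite /log2 ln_div ?posrE // mulrBl.
rewrite em in HN2.
have [N3 HN3] := pow2_small d0 e1.
exists (maxn N1 (maxn N2 N3)) => n; rewrite !geq_max => /and3P[n1 n2 n3] M K M0 MK.
pose a : R := 2 `^ (n%:R * ((\sum_i lam i * log2 (lam i)) + d)).
pose b : R := 2 `^ (- (n%:R * (m + d))).
pose mun (u : {ffun 'I_n -> U}) (i : {ffun 'I_n -> I}) := \prod_k mu (u k) (i k).
have qn0 (u : {ffun 'I_n -> U}) : 0 <= prodw q u by apply: prodw_ge0.
have dsn (u : {ffun 'I_n -> U}) := diagform_tensor (fun k => ds (u k)).
have dWn : diagform (fun a i : {ffun 'I_n -> I} => \prod_k W (a k) (i k))
    (prodw lam) (fun i j => \sum_(u : {ffun 'I_n -> U}) iid_state s u i j).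
  have := diagform_tensor (fun k : 'I_n => dW).
  have -> // : (fun x y : {ffun 'I_n -> I} => \prod_k \sum_u s u (x k) (y k)) =
     (fun i j => \sum_(u : {ffun 'I_n -> U}) iid_state s u i j).
  apply/funext => x; apply/funext => y.
  by rewrite (@sum_ffun_prod _ _ _ (fun k u => s u (x k) (y k))).
have b0 : 0 < b := pow2_gt0 _.
have [D [Dp De]] := good_decoder_packing K qn0 (prodw_sum _ q1)
  (fun u => optr_iid_state u trs) dsn dWn (ltW (pow2_gt0 _) : 0 <= a) b0 M0.
exists D; split=> // m1 k1; apply: (le_trans (De m1 k1)).
have E1 : \sum_(k | a < prodw lam k) prodw lam k <= e / 32 := HN1 n n1.
(* The law of large numbers is used on pairs of a letter and an eigenvalue index: a small
   conditional eigenvalue is a large product of ratios [q / mu]. *)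
have E2 : \sum_(u : {ffun 'I_n -> U}) \sum_(i | mun u i < prodw q u * b) mun u i <= e / 32.
  apply: le_trans (HN2 n n2); rewrite [leRHS]big_mkcond sum_ffun_pair.
  apply: ler_sum => u _; rewrite big_mkcond; apply: ler_sum => i _ /=.
  have -> : prodw (fun o => mu o.1 o.2) [ffun k => (u k, i k)] = mun u i.
    by apply: eq_bigr => k _; rewrite ffunE.
  have mun0 : 0 <= mun u i by apply: prodr_ge0.
  case: ifP => [small|_]; last by case: ifP.
  have [->|mn] := eqVneq (mun u i) 0; first by case: ifP.
  have mp : 0 < mun u i by rewrite lt_def mn.
  rewrite ifT //.
  rewrite (eq_bigr (fun k => q (u k) * (mu (u k) (i k))^-1)); last first.
    by move=> k _; rewrite !ffunE.
  rewrite big_split /= prodfV -/(mun u i) ltr_pdivlMr //.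
  by move: small; rewrite /b pow2N ltr_pdivlMr ?pow2_gt0 // mulrC.
have E3 : (M * K)%:R * (a / b) <= e / 32.
  apply: le_trans (HN3 n n3); rewrite /b pow2N invrK /a -pow2D.
  apply: (le_trans (ler_wpM2r (ltW (pow2_gt0 _)) MK)); rewrite -pow2D.
  rewrite mE le_eqVlt; apply/orP; left; apply/eqP; congr (_ `^ _); ring.
apply: (@le_trans _ _ (9 * (e / 32) + 8 * (e / 32) + 4 * (e / 32))); last by lra.
by rewrite !lerD // ler_wpM2l.
Qed.

(** The exponent is $I(U_1;U_2)+d$. Marginals of a product distribution are products, so this is the
    law of large numbers for the logarithm of the likelihood ratio. *)
Lemma iid_covering (U1 U2 : finType) (p : U1 -> U2 -> R) (d e : R) :
  (forall u1 u2, 0 <= p u1 u2) -> \sum_u1 \sum_u2 p u1 u2 = 1 -> 0 < d -> 0 < e ->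
  exists N : nat, forall n : nat, (N <= n)%N ->
    prob_atypical (fun (v1 : {ffun 'I_n -> U1}) (v2 : {ffun 'I_n -> U2}) =>
        \prod_k p (v1 k) (v2 k))
      (2 `^ (n%:R * (- \sum_u1 marg_l p u1 * log2 (marg_l p u1)
         - \sum_u2 marg_r p u2 * log2 (marg_r p u2)
         + \sum_u1 \sum_u2 p u1 u2 * log2 (p u1 u2) + d))) <= e.
Proof.
move=> p0 p1 d0 e0.
have pl u1 u2 := le_marg_l p0 u1 u2; have pr u1 u2 := le_marg_r p0 u1 u2.
have [||||| N HN] := @iid_product_large R (U1 * U2)%type (fun o => p o.1 o.2)
    (fun o => p o.1 o.2 / (marg_l p o.1 * marg_r p o.2)) d e => //.
- by rewrite sum_pair -p1.
- move=> o h; rewrite divr_gt0 // mulr_gt0 //; first exact: lt_le_trans h (pl _ _).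
  exact: lt_le_trans h (pr _ _).
exists N => n nN; apply: le_trans (HN n nN).
have -> : \sum_o p o.1 o.2 * log2 (p o.1 o.2 / (marg_l p o.1 * marg_r p o.2)) =
   - \sum_u1 marg_l p u1 * log2 (marg_l p u1)
   - \sum_u2 marg_r p u2 * log2 (marg_r p u2) + \sum_u1 \sum_u2 p u1 u2 * log2 (p u1 u2).
  rewrite sum_pair /=.
  rewrite (_ : \sum_u2 marg_r p u2 * log2 (marg_r p u2) =
     \sum_u1 \sum_u2 p u1 u2 * log2 (marg_r p u2)); last first.
    rewrite exchange_big; apply: eq_bigr => u2 _ /=; by rewrite -mulr_suml.
  rewrite (_ : \sum_u1 marg_l p u1 * log2 (marg_l p u1) =
     \sum_u1 \sum_u2 p u1 u2 * log2 (marg_l p u1)); last first.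
    by apply: eq_bigr => u1 _; rewrite -mulr_suml.
  rewrite -!sumrN -!big_split; apply: eq_bigr => u1 _ /=.
  rewrite -!sumrN -!big_split; apply: eq_bigr => u2 _ /=.
  have [->|pn] := eqVneq (p u1 u2) 0; first by rewrite !mul0r oppr0 !addr0.
  have pp : 0 < p u1 u2 by rewrite lt_def pn p0.
  have lp : 0 < marg_l p u1 := lt_le_trans pp (pl _ _).
  have rp : 0 < marg_r p u2 := lt_le_trans pp (pr _ _).
  by rewrite /log2 ln_div ?posrE ?mulr_gt0 // lnM ?posrE //; ring.
set t := 2 `^ _.
rewrite /prob_atypical [leRHS]big_mkcond sum_ffun_pair; apply: ler_sum => v1 _.
rewrite big_mkcond; apply: ler_sum => v2 _ /=.
have -> : prodw (fun o => p o.1 o.2) [ffun k => (v1 k, v2 k)] = \prod_k p (v1 k) (v2 k).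
  by apply: eq_bigr => k _; rewrite ffunE.
have Pn0 : 0 <= \prod_k p (v1 k) (v2 k) by apply: prodr_ge0.
case: ifP => [|_]; last by case: ifP.
rewrite /atypical /marg_l /marg_r (@sum_ffun_prod _ _ _ (fun k => p (v1 k))).
rewrite (@sum_ffun_prod _ _ _ (fun k u => p u (v2 k))) => big.
rewrite ifT //.
rewrite (eq_bigr (fun k => p (v1 k) (v2 k) * (marg_l p (v1 k) * marg_r p (v2 k))^-1)).
  have t0 : 0 < t := pow2_gt0 _.
  have Pp : 0 < \prod_k p (v1 k) (v2 k).
    apply: le_lt_trans big; rewrite mulr_ge0 ?(ltW t0) // mulr_ge0 //.
      by apply: prodr_ge0 => k _; apply: (marg_l_ge0 p0).
    by apply: prodr_ge0 => k _; apply: (marg_r_ge0 p0).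
  have pk k : 0 < p (v1 k) (v2 k).
    rewrite lt_def p0 andbT; apply: contraTneq Pp => pk.
    by rewrite (bigD1 k) //= pk mul0r ltxx.
  rewrite big_split /= prodfV big_split /= ltr_pdivlMr // mulr_gt0 // prodr_gt0 // => k _.
    exact: lt_le_trans (pk k) (pl _ _).
  exact: lt_le_trans (pk k) (pr _ _).
by move=> k _; rewrite !ffunE.
Qed.

End Asymptotics.

(** * Entropies and rates *)

Section MartonRegion.
Variable R : realType.
Implicit Types (I J U : finType).
Local Notation "z ^*" := (cconj z) : ring_scope.

(** * Reduced states, their positivity and their traces *)

Lemma psd_ptr2 I J (A : Op R (I * J)%type) : psd A -> psd (ptr2 A).
Proof.
move=> /psd_factor[B ->].
suff -> : ptr2 (gram B) = gram (fun (e : J * (I * J)) i => B e.2 (i, e.1)) by apply: psd_gram.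
by apply/funext => i; apply/funext => i'; rewrite /ptr2 /gram sum_pair.
Qed.

Lemma psd_ptr1 I J (A : Op R (I * J)%type) : psd A -> psd (ptr1 A).
Proof.
move=> /psd_factor[B ->].
suff -> : ptr1 (gram B) = gram (fun (e : I * (I * J)) j => B e.2 (e.1, j)) by apply: psd_gram.
by apply/funext => j; apply/funext => j'; rewrite /ptr1 /gram sum_pair.
Qed.

Lemma psd_scale I (a : R) (A : Op R I) : 0 <= a -> psd A -> psd (fun i j => a%:C * A i j).
Proof.
move=> a0 pA; apply/(psdE _) => v.
rewrite (_ : qf _ v = a%:C * qf A v).
  by rewrite mulr_ge0 ?ler0c //; apply: (psdE _).1.
rewrite /qf mulr_sumr; apply: eq_bigr => i _; rewrite mulr_sumr.
by apply: eq_bigr => j _; ring.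
Qed.

Lemma psd_state_l (V1 V2 J1 J2 : finType) (P : V1 -> V2 -> R)
    (tau : V1 -> V2 -> Op R (J1 * J2)%type) v1 :
  (forall v1 v2, 0 <= P v1 v2) -> (forall v1 v2, density (tau v1 v2)) ->
  psd (state_l P tau v1).
Proof.
move=> P0 taud; apply: (@psd_sum _ _ _ _ _ (fun v2 i j => (P v1 v2)%:C * ptr2 (tau v1 v2) i j)).
by move=> v2 _; apply: psd_scale => //; apply: psd_ptr2; case: (taud v1 v2).
Qed.

Lemma psd_state_r (V1 V2 J1 J2 : finType) (P : V1 -> V2 -> R)
    (tau : V1 -> V2 -> Op R (J1 * J2)%type) v2 :
  (forall v1 v2, 0 <= P v1 v2) -> (forall v1 v2, density (tau v1 v2)) ->
  psd (state_r P tau v2).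
Proof.
move=> P0 taud; apply: (@psd_sum _ _ _ _ _ (fun v1 i j => (P v1 v2)%:C * ptr1 (tau v1 v2) i j)).
by move=> v1 _; apply: psd_scale => //; apply: psd_ptr1; case: (taud v1 v2).
Qed.

Lemma optr_state_l (V1 V2 J1 J2 : finType) (P : V1 -> V2 -> R)
    (tau : V1 -> V2 -> Op R (J1 * J2)%type) v1 :
  (forall v1 v2, density (tau v1 v2)) -> optr (state_l P tau v1) = (marg_l P v1)%:C.
Proof.
move=> taud; rewrite /marg_l realc_sum /optr exchange_big; apply: eq_bigr => v2 _ /=.
by rewrite -mulr_sumr -[RHS]mulr1; case: (taud v1 v2) => _ <-; rewrite /optr sum_pair.
Qed.

Lemma optr_state_r (V1 V2 J1 J2 : finType) (P : V1 -> V2 -> R)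
    (tau : V1 -> V2 -> Op R (J1 * J2)%type) v2 :
  (forall v1 v2, density (tau v1 v2)) -> optr (state_r P tau v2) = (marg_r P v2)%:C.
Proof.
move=> taud; rewrite /marg_r realc_sum /optr exchange_big; apply: eq_bigr => v1 _ /=.
rewrite -mulr_sumr -[RHS]mulr1; case: (taud v1 v2) => _ <-.
by rewrite /optr sum_pair [in RHS]exchange_big.
Qed.

Section Nstate.
Variables (X I1 I2 : finType) (rho : X -> Op R (I1 * I2)%type).
Hypothesis rhod : forall x, density (rho x).

Lemma density_nstate n (x : 'I_n -> X) : density (nstate rho x).
Proof.
split.
  have /choice[B HB] y : exists B : Op R (I1 * I2)%type, rho y = gram B
    by apply: psd_factor; case: (rhod y).
  suff -> : nstate rho x = gram (fun (e : {ffun 'I_n -> I1 * I2})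
      (a : {ffun 'I_n -> I1} * {ffun 'I_n -> I2}) => \prod_k B (x k) (e k) (a.1 k, a.2 k)).
    exact: psd_gram.
  apply/funext => a; apply/funext => b; rewrite /nstate /gram.
  under [RHS]eq_bigr do rewrite cconj_prod -big_split /=.
  rewrite (@sum_ffun_prod _ _ _ (fun k e =>
    (B (x k) e (a.1 k, a.2 k))^* * B (x k) e (b.1 k, b.2 k))).
  by apply: eq_bigr => k _; rewrite HB.
rewrite /optr /nstate sum_pair /=.
under eq_bigr => a1 do rewrite (@sum_ffun_prod _ _ _
   (fun k j => rho (x k) (a1 k, j) (a1 k, j))).
rewrite (@sum_ffun_prod _ _ _ (fun k i => \sum_j rho (x k) (i, j) (i, j))).
by rewrite big1 // => k _; case: (rhod (x k)) => _ <-; rewrite /optr sum_pair.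
Qed.

Lemma ptr2_nstate n (x : 'I_n -> X) a b :
  ptr2 (nstate rho x) a b = \prod_k ptr2 (rho (x k)) (a k) (b k).
Proof. exact: (@sum_ffun_prod _ _ _ (fun k j => rho (x k) (a k, j) (b k, j))). Qed.

Lemma ptr1_nstate n (x : 'I_n -> X) a b :
  ptr1 (nstate rho x) a b = \prod_k ptr1 (rho (x k)) (a k) (b k).
Proof. exact: (@sum_ffun_prod _ _ _ (fun k j => rho (x k) (j, a k) (j, b k))). Qed.

Variables (U1 U2 : finType) (p : U1 -> U2 -> R) (f : U1 -> U2 -> X).
Let rhof u1 u2 := rho (f u1 u2).

Lemma state_l_iid n (v1 : {ffun 'I_n -> U1}) :
  state_l (fun (v1 : {ffun 'I_n -> U1}) (v2 : {ffun 'I_n -> U2}) => \prod_k p (v1 k) (v2 k))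
    (fun v1 v2 => nstate rho (fun k => f (v1 k) (v2 k))) v1 =
  iid_state (state_l p rhof) v1.
Proof.
apply/funext => a; apply/funext => b; rewrite /state_l /iid_state /=.
under eq_bigr do rewrite ptr2_nstate realc_prod -big_split /=.
exact: (@sum_ffun_prod _ _ _ (fun k u2 =>
  (p (v1 k) u2)%:C * ptr2 (rho (f (v1 k) u2)) (a k) (b k))).
Qed.

Lemma state_r_iid n (v2 : {ffun 'I_n -> U2}) :
  state_r (fun (v1 : {ffun 'I_n -> U1}) (v2 : {ffun 'I_n -> U2}) => \prod_k p (v1 k) (v2 k))
    (fun v1 v2 => nstate rho (fun k => f (v1 k) (v2 k))) v2 =
  iid_state (state_r p rhof) v2.
Proof.
apply/funext => a; apply/funext => b; rewrite /state_r /iid_state /=.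
under eq_bigr do rewrite ptr1_nstate realc_prod -big_split /=.
exact: (@sum_ffun_prod _ _ _ (fun k u1 =>
  (p u1 (v2 k))%:C * ptr1 (rho (f u1 (v2 k))) (a k) (b k))).
Qed.

End Nstate.

(** The blocks carry the probabilities as their traces. The states of $U_1B_1$ and $U_2B_2$ have
    this form, by [theta_U1B1E] and [theta_U2B2E]. *)
Definition cq_state U I (s : U -> Op R I) : Op R (U * I)%type :=
  fun a b => (a.1 == b.1)%:R * s a.1 a.2 b.2.

Lemma spectrum_opdiag I (l : I -> R) : spectrum (opdiag l) l.
Proof.
have adj1 : adj (@opid R I) = @opid R I.
  apply/funext => i; apply/funext => j; rewrite /adj /opid eq_sym -/(cconj _).
  exact: cconj_nat.
have mul1 A : opmul A (@opid R I) = A.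
  apply/funext => i; apply/funext => j; rewrite /opmul /opid.
  by rewrite -(sum_delta j (fun k => A i k)); apply: eq_bigr => k _; rewrite mulrC.
have mul1l A : opmul (@opid R I) A = A.
  apply/funext => i; apply/funext => j; rewrite /opmul /opid.
  by rewrite -(sum_delta i (fun k => A k j)); apply: eq_bigr => k _; rewrite eq_sym.
by exists (@opid R I); split; [split|]; rewrite adj1 ?mul1 ?mul1l.
Qed.

(** The eigenvectors are the basis vectors of the classical register tensored with those of the
    blocks, so the three entropies are those of [q], [lam] and [mu]. *)
Lemma qmi_cq_state U I (s : U -> Op R I) q V mu W lam :
  (forall u, optr (s u) = (q u)%:C) -> (forall u, diagform (V u) (mu u) (s u)) ->
  diagform W lam (fun i j => \sum_u s u i j) ->
  qmi (cq_state s) = - \sum_u q u * log2 (q u) - \sum_i lam i * log2 (lam i)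
    + \sum_u \sum_i mu u i * log2 (mu u i).
Proof.
move=> trs ds dW; rewrite /qmi.
have uV u : unitary (V u) by case: (ds u).
have -> : ptr2 (cq_state s) = opdiag q.
  apply/funext => u; apply/funext => u'.
  by rewrite /ptr2 /cq_state /opdiag /= -mulr_sumr -trs.
have -> : ptr1 (cq_state s) = (fun i j => \sum_u s u i j).
  apply/funext => i; apply/funext => j; rewrite /ptr1 /cq_state /=.
  by apply: eq_bigr => u _; rewrite eqxx mul1r.
rewrite (vN_entropyE (spectrum_opdiag q)) (vN_entropyE (diagform_spectrum dW)).
suff dB : diagform (fun a b : U * I => (b.1 == a.1)%:R * V a.1 a.2 b.2)
    (fun a => mu a.1 a.2) (cq_state s).
  by rewrite (vN_entropyE (diagform_spectrum dB)) opprK sum_pair.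
have eqp (a b : U * I) : (a == b) = (a.1 == b.1) && (a.2 == b.2) by case: a; case: b.
split.
- split; apply/funext => a; apply/funext => b; rewrite /opmul /adj /opid eqp sum_pair /=.
    rewrite (eq_bigr (fun u => (u == a.1)%:R * ((u == b.1)%:R *
        \sum_i V a.1 a.2 i * (V b.1 b.2 i)^*))).
      rewrite sum_delta; case: eqP => [->|_] /=; last by rewrite mul0r.
      by rewrite mul1r unitary_rowE.
    move=> u _; rewrite !mulr_sumr; apply: eq_bigr => i _.
    by rewrite -/(cconj _) cconjM cconj_nat; ring.
  rewrite (eq_bigr (fun u => (u == a.1)%:R * ((b.1 == u)%:R *
        \sum_i (V u i a.2)^* * V u i b.2))).
    rewrite sum_delta eq_sym; case: eqP => [->|_] /=; last by rewrite mul0r.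
    by rewrite mul1r unitary_colE.
  move=> u _; rewrite !mulr_sumr; apply: eq_bigr => i _.
  by rewrite -/(cconj _) cconjM cconj_nat [a.1 == u]eq_sym; ring.
- move=> a b; rewrite sum_pair /= /cq_state.
  rewrite (eq_bigr (fun u => (u == a.1)%:R * ((u == b.1)%:R *
      \sum_i (mu u i)%:C * (V a.1 a.2 i * (V b.1 b.2 i)^*)))).
    rewrite sum_delta; case: eqP => [<-|_] /=; last by rewrite !mul0r.
    by case: (ds a.1) => _ ->.
  move=> u _; rewrite !mulr_sumr; apply: eq_bigr => i _.
  by rewrite cconjM cconj_nat; ring.
- by move=> a; case: (ds a.1).
Qed.

Section Theta.
Variables (X I1 I2 U1 U2 : finType) (rho : X -> Op R (I1 * I2)%type).
Variables (p : U1 -> U2 -> R) (f : U1 -> U2 -> X).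
Hypothesis rhod : forall x, density (rho x).
Let rhof u1 u2 := rho (f u1 u2).

Lemma theta_U1B1E : theta_U1B1 rho p f = cq_state (state_l p rhof).
Proof.
apply/funext => -[u a]; apply/funext => -[u' b].
rewrite /theta_U1B1 /ptr2 /relabel /theta /reorder1 /cq_state /state_l sum_pair /=.
rewrite mulr_sumr; apply: eq_bigr => u2 _; rewrite /ptr2 !mulr_sumr.
by apply: eq_bigr => j _; rewrite xpair_eqE eqxx andbT mulrA.
Qed.

Lemma theta_U2B2E : theta_U2B2 rho p f = cq_state (state_r p rhof).
Proof.
apply/funext => -[u a]; apply/funext => -[u' b].
rewrite /theta_U2B2 /ptr2 /relabel /theta /reorder2 /cq_state /state_r sum_pair /=.
rewrite mulr_sumr; apply: eq_bigr => u1 _; rewrite /ptr1 !mulr_sumr.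
by apply: eq_bigr => j _; rewrite xpair_eqE eqxx mulrA.
Qed.

Lemma qmi_theta_U1U2 : qmi (theta_U1U2 rho p f) =
  - \sum_u1 marg_l p u1 * log2 (marg_l p u1)
  - \sum_u2 marg_r p u2 * log2 (marg_r p u2)
  + \sum_u1 \sum_u2 p u1 u2 * log2 (p u1 u2).
Proof.
have -> : theta_U1U2 rho p f = opdiag (fun a => p a.1 a.2).
  apply/funext => a; apply/funext => b; rewrite /theta_U1U2 /ptr2 /theta /opdiag /=.
  by rewrite -mulr_sumr; case: (rhod (f a.1 a.2)) => _ h; rewrite [X in _ * X]h mulr1.
rewrite /qmi.
have -> : ptr2 (opdiag (fun a => p a.1 a.2)) = opdiag (marg_l p).
  apply/funext => u; apply/funext => u'; rewrite /ptr2 /opdiag /marg_l realc_sum mulr_sumr.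
  by apply: eq_bigr => v _; rewrite xpair_eqE eqxx andbT.
have -> : ptr1 (opdiag (fun a => p a.1 a.2)) = opdiag (marg_r p).
  apply/funext => u; apply/funext => u'; rewrite /ptr1 /opdiag /marg_r realc_sum mulr_sumr.
  by apply: eq_bigr => v _; rewrite xpair_eqE eqxx.
by rewrite !(vN_entropyE (spectrum_opdiag _)) opprK sum_pair.
Qed.

End Theta.

(** * Message counts and the rates of the two receivers *)

Lemma msg_count_exists n (r : R) : exists M, msg_count n r M.
Proof.
have hb : exists M, 2 `^ (n%:R * r) <= M%:R.
  by exists (Num.bound ((2 : R) `^ (n%:R * r))); apply/ltW/archi_boundP/ltW/pow2_gt0.
case: (ex_minnP hb) => M leM minM; exists M; split=> //.
case: M leM minM => [|M] leM minM; first exact: pow2_gt0.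
by rewrite ltNge; apply/negP => /minM; rewrite ltnn.
Qed.

Lemma msg_count_gt0 n (r : R) M : msg_count n r M -> (0 < M)%N.
Proof.
by case=> _; case: M => // h; have := pow2_gt0 (n%:R * r); rewrite ltNge h.
Qed.

(** Here $0<2^{nr}\le 1$ rounds up to 1. This applies to the common message, of rate [0 - delta],
    and to a personal rate at most [delta]. *)
Lemma msg_count_npos n (r : R) M : r <= 0 -> msg_count n r M -> M = 1%N.
Proof.
move=> r0 hM; have := msg_count_gt0 hM; case: hM => h _.
have : (2 : R) `^ (n%:R * r) <= 1.
  by rewrite -[leRHS](powRr0 2) ler_powR ?ler1n // mulr_ge0_le0.
move=> /(lt_le_trans h); rewrite ltrn1 => /eqP; by case: M h => [|[|]].
Qed.

(** Rounding up adds less than 1, which is at most $2^{nr}$ itself at a nonnegative rate. *)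
Lemma msg_count_le n (r : R) M : 0 <= r -> msg_count n r M ->
  M%:R <= 2 * 2 `^ (n%:R * r).
Proof.
move=> r0 hM; have := msg_count_gt0 hM; case: hM => h _.
have : 1 <= (2 : R) `^ (n%:R * r).
  by rewrite -[leLHS](powRr0 2) ler_powR ?ler1n // mulr_ge0.
case: M h => // M /= h1 h2 _; rewrite -natr1; lra.
Qed.

(** For [d < r] the message rate and the list rate add up to $I-d/2$, while [iid_packing] with slack
    [d / 8] allows $I-3d/8$; the remaining [d / 8] absorbs the factor 4 lost by rounding two counts
    up. For [r <= d] there is a single message, and the list rate [k] is arbitrary. *)
Lemma rate_decoder U I (s : U -> Op R I) (q : U -> R) (r k d e : R) :
  (forall u, 0 <= q u) -> \sum_u q u = 1 ->
  (forall u, psd (s u)) -> (forall u, optr (s u) = (q u)%:C) ->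
  0 < d -> 0 < e -> r <= qmi (cq_state s) ->
  exists N : nat, forall n : nat, (N <= n)%N -> forall M K : nat,
    msg_count n (r - d) M ->
    msg_count n (if r <= d then k else qmi (cq_state s) - r + d / 2) K ->
    good_decoder (@prodw R 'I_n U q) (@iid_state R U I s n) M K e.
Proof.
move=> q0 q1 ps trs d0 e0 ri.
case: (leP r d) => rd.
  exists 0%N => n _ M K /msg_count_npos -> ; last by rewrite subr_le0.
  move=> _; have [D [Dp De]] := good_decoder_single (@prodw R 'I_n U q) (@iid_state R U I s n) K.
  by exists D; split=> // m j; apply: le_trans (De m j) (ltW e0).
have /choice[V HV] u := psd_diagform (ps u).
have /choice[mu Hmu] u := HV u.
have [W [lam dW]] := psd_diagform (psd_sum (index_enum U) (P := predT) (fun u _ => ps u)).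
have d8 : 0 < d / 8 by rewrite divr_gt0.
have [N1 HN1] := iid_packing q0 q1 trs Hmu dW d8 e0.
rewrite -(qmi_cq_state trs Hmu dW) in HN1.
have q4 : 0 < 4^-1 :> R by rewrite invr_gt0.
have [N2 HN2] := pow2_small d8 q4.
exists (maxn N1 N2) => n; rewrite geq_max => /andP[n1 n2] M K hM hK.
apply: HN1 => //; first exact: msg_count_gt0 hM.
set i := qmi _ in ri hK *.
have r0 : 0 <= r - d by rewrite subr_ge0 ltW.
have k0 : 0 <= i - r + d / 2 by rewrite addr_ge0 ?subr_ge0 ?divr_ge0 // ltW.
rewrite natrM; apply: le_trans (ler_pM _ _ (msg_count_le r0 hM) (msg_count_le k0 hK)) _ => //.
rewrite mulrACA -pow2D.
have -> : n%:R * (i - 3 * (d / 8)) =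
    n%:R * (r - d) + n%:R * (i - r + d / 2) + n%:R * (d / 8) by field.
rewrite [leRHS]pow2D mulrC ler_pM2l ?pow2_gt0 //.
have := HN2 n n2; rewrite pow2N lef_pV2 ?posrE ?pow2_gt0 // => h.
by apply: le_trans h; rewrite -natrM.
Qed.

Lemma ge0_complexE (z : R[i]) : 0 <= z -> z = (complex.Re z)%:C.
Proof. by case: z => a b; rewrite lecE /= => /andP[/eqP -> _]. Qed.

End MartonRegion.

End Marton.

Theorem theorem6p2 (R : realType) (X I1 I2 U1 U2 : finType)
  (rho : X -> Op R ((I1 * I2)%type)) (hrho : forall x, density (rho x))
  (p : U1 -> U2 -> R)
  (hp0 : forall u1 u2, 0 <= p u1 u2)
  (hp1 : \sum_(u1 : U1) \sum_(u2 : U2) p u1 u2 = 1)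
  (f : U1 -> U2 -> X) (r1 r2 : R) :
  0 <= r1 -> 0 <= r2 ->
  r1 <= qmi (theta_U1B1 rho p f) ->
  r2 <= qmi (theta_U2B2 rho p f) ->
  r1 + r2 <= qmi (theta_U1B1 rho p f) + qmi (theta_U2B2 rho p f)
             - qmi (theta_U1U2 rho p f) ->
  achievable rho r1 0 r2.
Proof.
move=> r1_ge0 r2_ge0 h1 h2 h12 eps delta eps0 delta0.
pose rhof u1 u2 := rho (f u1 u2).
have rhofd u1 u2 : density (rhof u1 u2) := hrho (f u1 u2).
rewrite theta_U1B1E in h1 h12; rewrite theta_U2B2E in h2 h12.
rewrite (qmi_theta_U1U2 _ _ hrho) in h12.
set i1 := qmi _ in h1 h12; set i2 := qmi _ in h2 h12; set i12 := (_ + \sum_u1 _) in h12.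
(* Five terms of size at most [x], divided by [4 * (eps / 4)], contribute [eps / 4]; the two
   decoders and the parameter [s = eps / 4] account for the other three quarters. *)
pose x := eps ^+ 2 / 20.
have x0 : 0 < x by rewrite divr_gt0 ?exprn_gt0.
have e4 : 0 < eps / 4 by rewrite divr_gt0.
have d2 : 0 < delta / 2 by rewrite divr_gt0.
(* The list rate of a receiver with a single message, whose decoder allows any list; it is large
   enough to meet the covering condition alone. *)
pose kbig := `|i12| + delta.
pose k1 := if r1 <= delta then kbig else i1 - r1 + delta / 2.
pose k2 := if r2 <= delta then kbig else i2 - r2 + delta / 2.
have kbig_ge : i12 + delta <= kbig /\ delta <= kbig.
  by rewrite /kbig lerD2r ler_norm lerDr normr_ge0.
have k1_ge : delta / 2 <= k1 by rewrite /k1; case: (leP r1 delta) => _; lra.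
have k2_ge : delta / 2 <= k2 by rewrite /k2; case: (leP r2 delta) => _; lra.
have k12_ge : i12 + delta <= k1 + k2.
  (* If both rates exceed [delta] this is the sum-rate hypothesis; otherwise one list rate is [kbig]
     and the other is positive. *)
  by move: k1_ge k2_ge; rewrite /k1 /k2; case: (leP r1 delta) => _; case: (leP r2 delta) => _; lra.
have pl0 := marg_l_ge0 hp0; have pr0 := marg_r_ge0 hp0.
have pl1 := marg_l_sum hp1; have pr1 := marg_r_sum hp1.
have [N1 HN1] := rate_decoder kbig pl0 pl1
  (fun u => psd_state_l u hp0 rhofd) (fun u => optr_state_l p u rhofd) delta0 e4 h1.
have [N2 HN2] := rate_decoder kbig pr0 pr1
  (fun u => psd_state_r u hp0 rhofd) (fun u => optr_state_r p u rhofd) delta0 e4 h2.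
have [N3 HN3] := iid_covering hp0 hp1 d2 x0.
have [N4 HN4] := pow2_small d2 x0.
exists (maxn (maxn N1 N2) (maxn N3 N4)) => n; rewrite !geq_max.
move=> /andP[/andP[n1 n2] /andP[n3 n4]].
have [M1 hM1] := msg_count_exists n (r1 - delta).
have [M2 hM2] := msg_count_exists n (r2 - delta).
have [M hM] := msg_count_exists n (0 - delta).
have [K1 hK1] := msg_count_exists n k1.
have [K2 hK2] := msg_count_exists n k2.
exists M1, M, M2; split=> //; split=> //; split=> //.
have M_eq : M = 1%N by apply: msg_count_npos hM; rewrite sub0r oppr_le0 ltW.
subst M.
pose P (v1 : {ffun 'I_n -> U1}) (v2 : {ffun 'I_n -> U2}) := \prod_k p (v1 k) (v2 k).
pose tau (v1 : {ffun 'I_n -> U1}) (v2 : {ffun 'I_n -> U2}) :=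
  nstate rho (fun k => f (v1 k) (v2 k)).
have P0 v1 v2 : 0 <= P v1 v2 by apply: prodr_ge0.
have Pl : marg_l P = prodw (marg_l p).
  by apply/funext => v1; rewrite /marg_l (@sum_ffun_prod _ _ _ (fun k => p (v1 k))).
have Pr : marg_r P = prodw (marg_r p).
  by apply/funext => v2; rewrite /marg_r (@sum_ffun_prod _ _ _ (fun k u => p u (v2 k))).
have P1 : \sum_v1 \sum_v2 P v1 v2 = 1.
  by rewrite -[LHS]/(\sum_v1 marg_l P v1) Pl prodw_sum.
have taud v1 v2 : density (tau v1 v2) by apply: density_nstate.
(* The level is [delta / 2] above [i12], for typicality, and at least [delta / 2] below the total
   list rate, for covering. *)
pose t : R := 2 `^ (n%:R * (i12 + delta / 2)).
have t0 : 0 <= t by apply/ltW/pow2_gt0.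
have G1 : good_decoder (marg_l P) (state_l P tau) M1 K1 (eps / 4).
  rewrite Pl (_ : state_l P tau = @iid_state R U1 I1 (state_l p rhof) n).
    exact: HN1.
  by apply/funext => v1; apply: state_l_iid.
have G2 : good_decoder (marg_r P) (state_r P tau) M2 K2 (eps / 4).
  rewrite Pr (_ : state_r P tau = @iid_state R U2 I2 (state_r p rhof) n).
    exact: HN2.
  by apply/funext => v2; apply: state_r_iid.
have [y [D1 [D2 [D1p D2p De]]]] := oneshot_marton P0 P1 taud
  (msg_count_gt0 hM1) (msg_count_gt0 hK1) (msg_count_gt0 hM2) (msg_count_gt0 hK2)
  t0 e4 G1 G2.
have invK k K : delta / 2 <= k -> msg_count n k K -> K%:R^-1 <= x.
  move=> kd hK; apply: le_trans (HN4 n n4); rewrite pow2N.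
  rewrite lef_pV2 ?posrE ?pow2_gt0 ?ltr0n ?(msg_count_gt0 hK) //.
  by case: hK => _; apply: le_trans; rewrite ler_powR ?ler1n // ler_wpM2l.
have tK : t / (K1 * K2)%:R <= x.
  apply: le_trans (HN4 n n4).
  have K12 : 0 < (K1 * K2)%:R :> R by rewrite ltr0n muln_gt0 (msg_count_gt0 hK1) (msg_count_gt0 hK2).
  rewrite ler_pdivrMr // natrM.
  apply: (@le_trans _ _ (2 `^ (- (n%:R * (delta / 2))) * (2 `^ (n%:R * k1) * 2 `^ (n%:R * k2)))).
    rewrite -!pow2D /t ler_powR ?ler1n // -mulrDr -mulrN -mulrDr ler_wpM2l //; lra.
  apply: ler_wpM2l; first exact/ltW/pow2_gt0.
  by case: hK1 => _ hK1; case: hK2 => _ hK2; apply: ler_pM => //; exact/ltW/pow2_gt0.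
have {}De : (M1 * M2)%:R^-1 * (\sum_m1 \sum_m2
     rtr (opsub (@opid R ({ffun 'I_n -> I1} * {ffun 'I_n -> I2})%type)
       (optens (D1 m1) (D2 m2))) (tau (y m1 m2).1 (y m1 m2).2)) <= eps.
  apply: (le_trans De); set pa := prob_atypical P t.
  have pax : pa <= x by exact: HN3.
  have b1 := invK _ _ k1_ge hK1; have b2 := invK _ _ k2_ge hK2.
  have h : (2 * pa + K1%:R^-1 + K2%:R^-1 + t / (K1 * K2)%:R) / (4 * (eps / 4)) <= eps / 4.
    rewrite ler_pdivrMr; last by rewrite mulr_gt0.
    rewrite (_ : eps / 4 * _ = 5 * x); first by lra.
    by rewrite /x; field.
  lra.
pose dec1 (m : 'I_M1 * 'I_1) := D1 m.1.
pose dec2 (m : 'I_1 * 'I_M2) := D2 m.2.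
have dec1_povm : povm dec1.
  case: D1p => p1 s1; split=> [m|i j]; first exact: p1.
  by rewrite sum_pair -s1; apply: eq_bigr => m _; rewrite big_ord1.
have dec2_povm : povm dec2.
  case: D2p => p2 s2; split=> [m|i j]; first exact: p2.
  by rewrite sum_pair big_ord1 -s2.
exists (BCCode rho (fun m1 _ m2 k => f ((y m1 m2).1 k) ((y m1 m2).2 k))
  dec1_povm dec2_povm).
rewrite /avg_err /= muln1.
under eq_bigr do rewrite big_ord1.
(* The average error is a complex number. Each summand is the trace of a product of positive
   operators, hence equal to its real part, so the real bound transfers. *)
rewrite (eq_bigr (fun m1 => \sum_m2 (rtr (opsub
    (@opid R ({ffun 'I_n -> I1} * {ffun 'I_n -> I2})%type)
       (optens (D1 m1) (D2 m2))) (tau (y m1 m2).1 (y m1 m2).2))%:C)%C); last first.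
  move=> m1 _; apply: eq_bigr => m2 _; apply: ge0_complexE.
  apply: optr_psd_ge0; first exact: broadcast_error_psd.
  by case: (taud (y m1 m2).1 (y m1 m2).2).
under eq_bigr do rewrite -realc_sum.
rewrite -realc_sum.
have -> : ((M1 * M2)%:R^-1 : R[i]) = (((M1 * M2)%:R^-1 : R)%:C)%C.
  by rewrite fmorphV rmorph_nat.
by rewrite -rmorphM lecR.
Qed.
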